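(* For each domain $D\subset\mathbb C^n$ one has $$\kappa_D^{(2n-1)}=\hat\kappa_D .$$ On the other hand, if $n\ge 2$ and $$D_n=\Big\{z\in\mathbb C^n:\sum_{j=2}^n\big(2|z_1^3-z_j^3|+|z_1^3+z_j^3|\big)<2(n-1)\Big\},$$ then $$\kappa_{D_n}^{(2n-2)}(0;\cdot)\neq\hat\kappa_{D_n}(0;\cdot).$$
   Context: $\mathbb D$ is the open unit disc. For a domain $D\subset\mathbb C^n$, $z\in D$, $X\in\mathbb C^n$: the Kobayashi metric is $\kappa_D(z;X)=\inf\{|\alpha|:\exists f\in\mathcal O(\mathbb D,D),\ f(0)=z,\ \alpha f'(0)=X\}$; the Kobayashi metric of order $m\in\mathbb N$ is $\kappa_D^{(m)}(z;X)=\inf\{\sum_{j=1}^m\kappa_D(z;X_j):\sum_{j=1}^m X_j=X\}$; the Kobayashi--Buseman metric $\hat\kappa_D$ is defined by letting $\hat\kappa_D(z;\cdot)$ be the largest pseudonorm not exceeding $\kappa_D(z;\cdot)$; equivalently $\hat\kappa_D(z;X)=\inf\{\sum_{j=1}^m\kappa_D(z;X_j):m\in\mathbb N,\ \sum_{j=1}^mX_j=X\}$. *)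

(* Defs.v *)
From HB Require Import structures.
From mathcomp Require Import all_boot all_order all_algebra.
From mathcomp Require Import all_classical all_reals all_analysis.
From mathcomp Require Import complex.

Set Implicit Arguments.
Unset Strict Implicit.
Unset Printing Implicit Defensive.

Import Order.TTheory GRing.Theory Num.Theory.
Import numFieldNormedType.Exports.
Import Normc.

Local Open Scope classical_set_scope.
Local Open Scope ring_scope.

(* The field R[i], typed as a numClosedFieldType so that the topology and the
   normed module structure that MathComp-Analysis puts on every numFieldType
   are inferred on it and on row vectors over it. *)
Definition Cplx (R : realType) : numClosedFieldType := R[i].

Definition unit_disc (R : realType) : set (Cplx R) :=
  [set w | normc w < 1].

Definition domain (R : realType) (n : nat) (D : set 'rV[Cplx R]_n) : Prop :=
  [/\ D !=set0, open D & connected D].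

(* O(unit disc, D).  Only the values of f on the disc matter; the scalars are
   Cplx R, so derivability in the direction 1 is complex differentiability. *)
Definition holo_disc (R : realType) (n : nat) (D : set 'rV[Cplx R]_n)
    (f : Cplx R -> 'rV[Cplx R]_n) : Prop :=
  forall w, unit_disc w -> derivable f w 1 /\ D (f w).

Definition kobayashi (R : realType) (n : nat) (D : set 'rV[Cplx R]_n)
    (z X : 'rV[Cplx R]_n) : R :=
  inf [set normc a | a in [set a : Cplx R |
    exists f, [/\ holo_disc D f, f 0 = z & a *: (f^`()%classic 0) = X]]].

Definition kobayashi_order (R : realType) (n : nat) (D : set 'rV[Cplx R]_n)
    (m : nat) (z X : 'rV[Cplx R]_n) : R :=
  inf [set \sum_(j < m) kobayashi D z (Y j) |
    Y in [set Y : 'I_m -> 'rV[Cplx R]_n | \sum_(j < m) Y j = X]].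

Definition pseudonorm (R : realType) (n : nat) (p : 'rV[Cplx R]_n -> R) : Prop :=
  [/\ forall X, 0 <= p X,
      forall X Y, p (X + Y) <= p X + p Y &
      forall (a : Cplx R) X, p (a *: X) = normc a * p X].

(* The largest pseudonorm below kobayashi D z, obtained as the pointwise
   supremum of all of them; kobayashi_busemanP proves that it is one. *)
Definition kobayashi_buseman (R : realType) (n : nat) (D : set 'rV[Cplx R]_n)
    (z X : 'rV[Cplx R]_n) : R :=
  sup [set p X | p in [set p : 'rV[Cplx R]_n -> R |
    pseudonorm p /\ forall Y, p Y <= kobayashi D z Y]].

(* The domain D_n of C^n for n = k.+1; z_1 is the coordinate of index ord0. *)
Definition cubic_domain (R : realType) (k : nat) : set 'rV[Cplx R]_k.+1 :=
  [set z | \sum_(j < k.+1 | j != ord0)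
      (2 * normc (z ord0 ord0 ^+ 3 - z ord0 j ^+ 3)
       + normc (z ord0 ord0 ^+ 3 + z ord0 j ^+ 3)) < 2 * k%:R].

Lemma kobayashi_ge0 (R : realType) (n : nat) (D : set 'rV[Cplx R]_n) z X :
  0 <= kobayashi D z X.
Proof.
rewrite /kobayashi; set S := [set normc _ | _ in _].
have [->|/set0P S0] := eqVneq S set0; first by rewrite inf0.
apply: lb_le_inf => // _ [a _ <-].
by case: (a) => x y /=; exact: sqrtr_ge0.
Qed.

Lemma kobayashi_busemanP (R : realType) (n : nat) (D : set 'rV[Cplx R]_n) z :
  [/\ pseudonorm (kobayashi_buseman D z),
      forall X, kobayashi_buseman D z X <= kobayashi D z X &
      forall p, pseudonorm p -> (forall X, p X <= kobayashi D z X) ->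
        forall X, p X <= kobayashi_buseman D z X].
Proof.
pose P := [set p : 'rV[Cplx R]_n -> R |
  pseudonorm p /\ forall Y, p Y <= kobayashi D z Y].
have P0 : P (fun=> 0).
  split; last by move=> Y; exact: kobayashi_ge0.
  by split=> [X|X Y|a X]; rewrite ?addr0 ?mulr0.
have n0 X : [set p X | p in P] !=set0 by exists 0; exists (fun=> 0).
have ubP X : ubound [set p X | p in P] (kobayashi D z X).
  by move=> _ [p [_ pk] <-].
have leB p X : P p -> p X <= kobayashi_buseman D z X.
  by move=> Pp; apply: ub_le_sup; [exists (kobayashi D z X)|exists p].
have normc_ge0 (a : Cplx R) : 0 <= normc a.
  by case: a => x y /=; exact: sqrtr_ge0.
have leZ (a : Cplx R) X :
    kobayashi_buseman D z (a *: X) <= normc a * kobayashi_buseman D z X.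
  apply: ge_sup => // _ [p Pp <-]; have [[_ _ pZ] _] := Pp.
  by rewrite pZ ler_wpM2l// leB.
split; last by move=> p pn pk X; apply: leB.
- split=> [X|X Y|a X]; first exact: (leB _ _ P0).
    apply: ge_sup => // _ [p Pp <-]; have [[_ pD _] _] := Pp.
    by rewrite (le_trans (pD _ _))// lerD// leB.
  apply/eqP; rewrite eq_le leZ /=.
  have [->|a0] := eqVneq a 0.
    by rewrite normc0 mul0r; apply: (leB _ _ P0).
  have na0 : 0 < normc a.
    rewrite lt_neqAle normc_ge0 andbT eq_sym.
    by apply: contra a0 => /eqP/eq0_normc ->.
  rewrite mulrC -ler_pdivlMr// mulrC -normcV.
  by have := leZ a^-1 (a *: X); rewrite scalerA mulVf// scale1r.
- by move=> X; apply: ge_sup => //; exact: ubP.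
Qed.

(* Main.v *)
Require Import Defs.
From mathcomp Require Import all_boot all_order all_algebra.
From mathcomp Require Import all_classical all_reals all_analysis.
From mathcomp Require Import complex.
From mathcomp Require Import ring lra.

Set Implicit Arguments.
Unset Strict Implicit.
Unset Printing Implicit Defensive.

Import Order.TTheory GRing.Theory Num.Theory.
Import numFieldNormedType.Exports.
Import Normc.

Local Open Scope classical_set_scope.
Local Open Scope ring_scope.

(** The first part holds for every function [h] on [C^n] with
    [h (a *: X) = |a| h X]: a sum of vectors of total length [s] (measured by [h])
    can be rewritten as a sum of [2n - 1] vectors, of total length at most [s + eps]
    ([shorten_decomposition]). Minimise the length of a combination [sum b_i X_i] with the
    given sum over complex coefficients [b_i]. At the minimum a complex linear form takes
    the real value [|b_i| h X_i] at each [b_i X_i]; these vectors then lie in a real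
    hyperplane of [C^n], so [2n] of them satisfy a real linear relation, along which one
    can slide without increasing the length until a coefficient vanishes
    ([shorten_sum]). It follows that the metric of order [2n - 1] is a pseudonorm.

    For the second part, put [k = n - 1] and let [N] be the function with
    [D_n = {N < 2k}]; it is homogeneous of degree 3. Discs [w |-> w *: z] bound the
    Kobayashi metric at 0 from above. For the lower bound, [N] is a supremum of moduli of
    cubic forms, and a cubic form composed with a disc [f] through 0 is
    [w ^ 3] times a holomorphic function, to which the maximum principle applies
    ([cubic_gauge_derivative]). This principle is obtained, for functions that are merely
    complex differentiable, from the constancy of circle means ([circle_mean_Re]), that
    is, from Goursat's bisection argument on a rectangle in logarithmic polar
    coordinates ([corners_flux0]).

    Now [N z <= 2k] implies [|z_1| <= 1], with equality only if all [z_j ^ 3] agree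
    ([cubic_gauge_extremal]). So the vectors of metric 1 with [z_1 = 1] are those whose
    coordinates are cube roots of unity: they are the vertices of a product of [k]
    triangles, of real dimension [2k]. A point of this product has Kobayashi-Buseman
    metric 1, and a decomposition that realises it is a convex combination of vertices
    (a shortest decomposition exists by compactness, [attained_decomposition]). In
    barycentric coordinates the vertices have entries 0 and 1, and a point with generic
    coordinates is a combination of no [2k = 2n - 2] of them
    ([moment_point_outside_spans], [order_neq_buseman]). *)

(** * The complex plane *)

Lemma normc_ge0 (R : realType) (a : Cplx R) : 0 <= normc a.
Proof. by case: a => x y /=; exact: sqrtr_ge0. Qed.

Lemma normc_eq0 (R : realType) (a : Cplx R) : (normc a == 0) = (a == 0).
Proof. by apply/eqP/eqP => [/eq0_normc//|->]; rewrite normc0. Qed.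

Lemma normc_gt0 (R : realType) (a : Cplx R) : (0 < normc a) = (a != 0).
Proof. by rewrite lt_neqAle normc_ge0 andbT eq_sym normc_eq0. Qed.

Lemma normc_real (R : realType) (x : R) : normc (x%:C%C : Cplx R) = `|x|.
Proof. by rewrite /= expr0n addr0 sqrtr_sqr. Qed.

Lemma normcX (R : realType) (a : Cplx R) p : normc (a ^+ p) = normc a ^+ p.
Proof. by elim: p => [|p IH]; rewrite ?expr0 ?normc1// !exprS normcM IH. Qed.

Lemma sqr_normcE (R : realType) (a : Cplx R) :
  normc a ^+ 2 = complex.Re a ^+ 2 + complex.Im a ^+ 2.
Proof. by case: a => x y /=; rewrite sqr_sqrtr// addr_ge0 ?sqr_ge0. Qed.

Lemma Re_le_normc (R : realType) (a : Cplx R) : `|complex.Re a| <= normc a.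
Proof. by have := normc_ge_Re a; rewrite lecR. Qed.

Lemma Im_le_normc (R : realType) (a : Cplx R) : `|complex.Im a| <= normc a.
Proof.
rewrite -(ler_pXn2r (n := 2))// ?nnegrE ?normc_ge0// sqr_normcE real_normK ?num_real//.
by rewrite lerDr sqr_ge0.
Qed.

Lemma normc_le_ReIm (R : realType) (a : Cplx R) :
  normc a <= `|complex.Re a| + `|complex.Im a|.
Proof.
rewrite -(ler_pXn2r (n := 2))// ?nnegrE ?normc_ge0 ?addr_ge0// sqr_normcE.
rewrite sqrrD !real_normK ?num_real// lerD2r lerDl mulrn_wge0// mulr_ge0//.
Qed.

Lemma normc_sum (R : realType) (I : Type) (r : seq I) (P : pred I) (F : I -> Cplx R) :
  normc (\sum_(i <- r | P i) F i) <= \sum_(i <- r | P i) normc (F i).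
Proof.
apply: (big_ind2 (fun (x : Cplx R) (y : R) => normc x <= y)) => //.
  by rewrite normc0.
by move=> x y x' y' xy xy'; rewrite (le_trans (le_normcD _ _))// lerD.
Qed.

(** Written with a factor rather than a quotient, to include [a = 0]. *)
Lemma unimodular_phase (R : realType) (a : Cplx R) : exists2 u : Cplx R,
  normc u = 1 & u * a = (normc a)%:C%C.
Proof.
have [->|a0] := eqVneq a 0; first by exists 1; rewrite ?normc1// mulr0 normc0.
exists ((normc a)%:C%C / a); last by rewrite mulfVK.
rewrite normcM normcV normc_real ger0_norm ?normc_ge0// divff//.
by rewrite normc_eq0.
Qed.

Lemma ReD (R : realType) (x y : Cplx R) :
  complex.Re (x + y) = complex.Re x + complex.Re y.
Proof. by case: x => ? ?; case: y => ? ?. Qed.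

Lemma ImD (R : realType) (x y : Cplx R) :
  complex.Im (x + y) = complex.Im x + complex.Im y.
Proof. by case: x => ? ?; case: y => ? ?. Qed.

Lemma ReB (R : realType) (x y : Cplx R) :
  complex.Re (x - y) = complex.Re x - complex.Re y.
Proof. by case: x => ? ?; case: y => ? ?. Qed.

Lemma ImB (R : realType) (x y : Cplx R) :
  complex.Im (x - y) = complex.Im x - complex.Im y.
Proof. by case: x => ? ?; case: y => ? ?. Qed.

Lemma Re_sum (R : realType) (I : Type) (r : seq I) (P : pred I) (F : I -> Cplx R) :
  complex.Re (\sum_(i <- r | P i) F i) = \sum_(i <- r | P i) complex.Re (F i).
Proof. by apply: (big_morph (fun z : Cplx R => complex.Re z)) => // x y; exact: ReD. Qed.

Lemma Im_sum (R : realType) (I : Type) (r : seq I) (P : pred I) (F : I -> Cplx R) :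
  complex.Im (\sum_(i <- r | P i) F i) = \sum_(i <- r | P i) complex.Im (F i).
Proof. by apply: (big_morph (fun z : Cplx R => complex.Im z)) => // x y; exact: ImD. Qed.

Lemma ReZ (R : realType) (a : R) (x : Cplx R) :
  complex.Re (a%:C%C * x) = a * complex.Re x.
Proof. by case: x => u v /=; rewrite mul0r subr0. Qed.

Lemma ImZ (R : realType) (a : R) (x : Cplx R) :
  complex.Im (a%:C%C * x) = a * complex.Im x.
Proof. by case: x => u v /=; rewrite mul0r addr0. Qed.

(** * Continuity and compactness over the complex numbers *)

(** The norm of [Cplx R] takes its values in [Cplx R] itself; this gives
    neighbourhoods with real radii. *)
Lemma nbhs_normcP (R : realType) (z : Cplx R) (P : set (Cplx R)) :
  nbhs z P <-> exists2 e : R, 0 < e & forall y, normc (y - z) < e -> P y.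
Proof.
split.
  move=> /nbhs_ballP[e e0 eP].
  have := e0; rewrite /= ltcE /= => /andP[/eqP ei er].
  exists (complex.Re e) => // y yz; apply: eP.
  rewrite /ball/= -opprB normrN ltcE /= ei eqxx /=.
  by case: (y - z) yz => u v.
move=> [e e0 eP]; apply/nbhs_ballP; exists (e%:C%C : Cplx R).
  by rewrite /= ltcR.
move=> y; rewrite /ball/= -opprB normrN => yz; apply: eP.
by move: yz; rewrite -ltcR; case: (y - z).
Qed.

Lemma normc_continuous (R : realType) : continuous (@normc R : Cplx R -> R).
Proof.
move=> z P /nbhs_ballP[e /= e0 eP]; apply/nbhs_normcP; exists e => // y yz.
apply: eP; apply: le_lt_trans yz; rewrite -normrN opprB ler_norml; apply/andP; split.
  rewrite lerNl opprB lerBlDr.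
  by have := le_normcD (z - y) y; rewrite subrK -[normc (z - y)]normcN opprB.
by rewrite lerBlDr; have := le_normcD (y - z) z; rewrite subrK.
Qed.

Lemma Complex_continuous (R : realType) :
  continuous (fun p : R * R => (Complex p.1 p.2 : Cplx R)).
Proof.
move=> [x y] P /nbhs_normcP[e e0 eP].
have e20 : 0 < e / 2 by rewrite divr_gt0.
exists (ball x (e/2), ball y (e/2)); first by split; exact: nbhsx_ballx.
move=> [x' y'] /= [xx yy]; apply: eP.
apply: le_lt_trans (normc_le_ReIm _) _ => /=.
by rewrite -opprB normrN -(opprB y) normrN (splitr e) ltrD.
Qed.

(** Squares serve as compact sets of complex numbers: they are images of products
    of real segments. *)
Definition square (R : realType) (M : R) : set (Cplx R) :=
  [set z | `|complex.Re z| <= M /\ `|complex.Im z| <= M].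

Lemma compact_square (R : realType) (M : R) : compact (@square R M).
Proof.
have -> : square M = (fun p : R * R => (Complex p.1 p.2 : Cplx R)) @`
    (`[-M, M] `*` `[-M, M]).
  apply/seteqP; split => [[x y] [/= xM yM]|_ [[x y] /= [xM yM] <-]].
    by exists (x, y) => //; rewrite /= !in_itv /= -!ler_norml.
  by split; move: xM yM; rewrite /= !in_itv /= -!ler_norml.
apply: continuous_compact.
  by apply: continuous_subspaceT; exact: Complex_continuous.
by apply: compact_setX; exact: segment_compact.
Qed.

Lemma compact_squares (R : realType) (M : R) (N : nat) :
  compact [set v : 'rV[Cplx R]_N | forall i, square M (v ord0 i)].
Proof. exact: (@rV_compact (Cplx R) N (fun=> square M) (fun=> @compact_square R M)). Qed.

Lemma continuous_sum (T : topologicalType) (K : numFieldType) (V : normedModType K)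
    (I : Type) (r : seq I) (P : pred I) (f : I -> T -> V) :
  (forall i, P i -> continuous (f i)) ->
  continuous (fun x => \sum_(i <- r | P i) f i x).
Proof. by move=> cf; apply: continuous_big => //; exact: add_continuous. Qed.

Lemma continuous_add (T : topologicalType) (K : numFieldType) (f g : T -> K) :
  continuous f -> continuous g -> continuous (fun x => f x + g x).
Proof. by move=> cf cg x; apply: cvgD; [exact: cf|exact: cg]. Qed.

Lemma continuous_sub (T : topologicalType) (K : numFieldType) (f g : T -> K) :
  continuous f -> continuous g -> continuous (fun x => f x - g x).
Proof. by move=> cf cg x; apply: cvgB; [exact: cf|exact: cg]. Qed.

Lemma continuous_mul (T : topologicalType) (K : numFieldType) (f g : T -> K) :
  continuous f -> continuous g -> continuous (fun x => f x * g x).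
Proof. by move=> cf cg x; apply: cvgM; [exact: cf|exact: cg]. Qed.

Lemma continuous_normc (R : realType) (T : topologicalType) (f : T -> Cplx R) :
  continuous f -> continuous (fun x => normc (f x)).
Proof. by move=> cf x; apply: (cvg_comp _ _ (cf x)); exact: normc_continuous. Qed.

Lemma continuous_normr (R : realType) (T : topologicalType) (f : T -> R) :
  continuous f -> continuous (fun x => `|f x|).
Proof. by move=> cf x; apply: cvg_norm; exact: cf. Qed.

(** * Shortening a sum of vectors *)

(** A minimum exists because the weights [k i] are positive: a family of bounded
    cost has bounded coefficients, so the problem is one of a continuous function on
    a compact set. *)
Lemma cost_minimizer (R : realType) (n m : nat) (X : 'I_m -> 'rV[Cplx R]_n)
    (k : 'I_m -> R) : (forall i, 0 < k i) ->
  exists b : 'I_m -> Cplx R, \sum_i b i *: X i = \sum_i X i /\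
    forall b' : 'I_m -> Cplx R, \sum_i b' i *: X i = \sum_i X i ->
      \sum_i normc (b i) * k i <= \sum_i normc (b' i) * k i.
Proof.
move=> k0.
(* A coefficient family that costs at most as much as the constant family 1 lies
   in the box of size M, so minimising over that box is enough. *)
pose K0 := \sum_i k i; pose M := \sum_i K0 / k i.
have K00 : 0 <= K0 by apply: sumr_ge0 => i _; exact/ltW.
have leM i : K0 / k i <= M.
  rewrite /M (bigD1 i)//= lerDl sumr_ge0// => j _; rewrite divr_ge0//; exact/ltW.
have boxP (v : 'I_m -> Cplx R) : \sum_i normc (v i) * k i <= K0 ->
    forall i, square M (v i).
  move=> vK i; have nM : normc (v i) <= M.
    apply: le_trans (leM i); rewrite ler_pdivlMr//; apply: le_trans vK.
    by rewrite (bigD1 i)//= lerDl sumr_ge0// => j _; rewrite mulr_ge0 ?normc_ge0// ltW.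
  by split; apply: le_trans nM; rewrite ?Re_le_normc ?Im_le_normc.
pose G (v : 'rV[Cplx R]_m) : R := \sum_(j < n)
  normc (\sum_i v ord0 i * X i ord0 j - (\sum_i X i) ord0 j).
have GP v : G v = 0 <-> \sum_i v ord0 i *: X i = \sum_i X i.
  split=> [/eqP|e].
    rewrite psumr_eq0 => [/allP Gv|j _]; last exact: normc_ge0.
    apply/rowP => j; have := Gv j; rewrite mem_index_enum => /(_ isT).
    rewrite /= normc_eq0 subr_eq0 => /eqP <-; rewrite summxE.
    by apply: eq_bigr => i _; rewrite mxE.
  rewrite /G big1// => j _; rewrite -e summxE; apply/eqP.
  by rewrite normc_eq0 subr_eq0; apply/eqP/eq_bigr => i _; rewrite mxE.
have Gc : continuous G.
  apply: continuous_sum => j _; apply: continuous_normc.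
  apply: continuous_sub; last exact: cst_continuous.
  apply: (@continuous_sum _ _ (Cplx R)) => i _; apply: continuous_mul.
    exact: coord_continuous.
  exact: cst_continuous.
pose A := [set v : 'rV[Cplx R]_m | forall i, square M (v ord0 i)]
  `&` (G @^-1` [set 0]).
have cA : compact A.
  apply: compact_closedI; first exact: compact_squares.
  by move/continuous_closedP: Gc; apply; exact: closed_eq.
have A1 : A (\row_i 1).
  split; first by apply: boxP; apply: ler_sum => i _; rewrite mxE normc1 mul1r.
  by apply/GP; apply: eq_bigr => i _; rewrite mxE scale1r.
pose F (v : 'rV[Cplx R]_m) : R := \sum_i normc (v ord0 i) * k i.
have Fc : continuous F.
  apply: continuous_sum => i _; apply: continuous_mul; last exact: cst_continuous.
  by apply: continuous_normc; exact: coord_continuous.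
have [|v /[1!inE] vA vmin] := compact_EVT_min _ cA (continuous_subspaceT Fc).
  by exists (\row_i 1).
exists (fun i => v ord0 i); split; first by apply/GP; case: vA.
move=> b' b'X; have [b'K|/ltW Kb'] := leP (\sum_i normc (b' i) * k i) K0.
  have := vmin (\row_i b' i); rewrite inE /F.
  under [X in _ <= X]eq_bigr do rewrite mxE.
  apply; split; first by move=> i; rewrite mxE; exact: boxP.
  by apply/GP; rewrite -b'X; apply: eq_bigr => i _; rewrite mxE.
apply: le_trans Kb'; have := vmin (\row_i 1); rewrite inE => /(_ A1); rewrite /F.
by under [X in _ <= X]eq_bigr do rewrite mxE normc1 mul1r.
Qed.

(** [C^n] as the real vector space [R^(2n)], in which real linear relations between
    vectors can be found by rank arguments. *)
Definition realify (R : realType) (n : nat) (v : 'rV[Cplx R]_n) : 'rV[R]_(n + n) :=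
  row_mx (\row_j complex.Re (v ord0 j)) (\row_j complex.Im (v ord0 j)).

Lemma realify_inj (R : realType) (n : nat) : injective (@realify R n).
Proof.
move=> u v /eq_row_mx[/rowP re /rowP im]; apply/rowP => j.
have := re j; have := im j; rewrite !mxE.
by case: (u ord0 j) => a b; case: (v ord0 j) => c d /= -> ->.
Qed.

Lemma realify_sum (R : realType) (n m : nat) (c : 'rV[R]_m) (X : 'I_m -> 'rV[Cplx R]_n) :
  c *m (\matrix_i realify (X i)) = realify (\sum_i (c ord0 i)%:C%C *: X i).
Proof.
apply/rowP => j; rewrite mxE.
under eq_bigr do rewrite mxE.
by case: (split_ordP j) => i ->; rewrite /realify ?row_mxEl ?row_mxEr !mxE summxE
  ?Re_sum ?Im_sum; apply: eq_bigr => l _; rewrite ?row_mxEl ?row_mxEr !mxE ?ReZ ?ImZ.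
Qed.

(** This is Caratheodory's argument with one dimension gained from the complex
    structure. At a minimum of the complex [l^1] cost, all the vectors [b i *: X i] lie in
    a real hyperplane (the one where a supporting complex linear form is real), so that
    even [2n] of them are linearly dependent over the reals. The hyperplane is not
    constructed: if the vectors formed a real basis, then expanding [i] times their
    sum would produce a cheaper family of coefficients. *)
Lemma shorten_sum (R : realType) (n m : nat) (X : 'I_m.+1 -> 'rV[Cplx R]_n)
    (k : 'I_m.+1 -> R) : (n + n <= m.+1)%N -> (forall i, 0 < k i) ->
  exists b : 'I_m.+1 -> Cplx R, [/\ \sum_i b i *: X i = \sum_i X i,
    \sum_i normc (b i) * k i <= \sum_i k i & exists i, b i = 0].
Proof.
move=> nm k0; have [b [bX bmin]] := cost_minimizer X k0.
have bk : \sum_i normc (b i) * k i <= \sum_i k i.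
  have := bmin (fun=> 1); under eq_bigr do rewrite scale1r.
  by move=> /(_ erefl); under [X in _ <= X]eq_bigr do rewrite normc1 mul1r.
have [[i bi0]|b0] := pselect (exists i, b i = 0).
  by exists b; split => //; exists i.
have K0 i : 0 < normc (b i) * k i.
  by rewrite mulr_gt0// normc_gt0; apply/eqP => bi0; apply: b0; exists i.
pose A : 'M[R]_(m.+1, n + n) := \matrix_i realify (b i *: X i).
(* A real linear relation between the vectors lets us slide along it, without
   increasing the cost, until a coefficient vanishes. *)
have slide (c : 'rV[R]_m.+1) : c != 0 -> c *m A = 0 -> exists b : 'I_m.+1 -> Cplx R,
    [/\ \sum_i b i *: X i = \sum_i X i,
    \sum_i normc (b i) * k i <= \sum_i k i & exists i, b i = 0].
  wlog cK : c / 0 <= \sum_i c ord0 i * (normc (b i) * k i).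
    move=> wl c0 cA; have [cK|/ltW cK] := leP 0 (\sum_i c ord0 i * (normc (b i) * k i)).
      exact: (wl c).
    apply: (wl (- c)); rewrite ?oppr_eq0// ?mulNmx ?cA ?oppr0//.
    under eq_bigr do rewrite mxE mulNr.
    by rewrite sumrN oppr_ge0.
  move=> c0 cA.
  have cX : \sum_i (c ord0 i)%:C%C *: (b i *: X i) = 0.
    apply: realify_inj; rewrite -realify_sum cA.
    by apply/rowP => j; rewrite /realify !mxE; case: splitP => ? _; rewrite !mxE.
  pose i0 := [arg max_(i > ord0) c ord0 i]%O.
  have cmax i : c ord0 i <= c ord0 i0.
    by rewrite /i0; case: arg_maxP => // j _; exact.
  have ci0 : 0 < c ord0 i0.
    rewrite ltNge; apply/negP => ci0.
    have cle i : c ord0 i * (normc (b i) * k i) <= 0.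
      by rewrite pmulr_lle0//; apply: le_trans ci0.
    have : \sum_i - (c ord0 i * (normc (b i) * k i)) == 0.
      rewrite eq_le sumr_ge0 ?andbT; last by move=> i _; rewrite oppr_ge0.
      by rewrite sumrN oppr_le0.
    rewrite psumr_eq0; last by move=> i _; rewrite oppr_ge0.
    move=> /allP cz; case/eqP: c0; apply/rowP => i; rewrite mxE.
    have := cz i; rewrite mem_index_enum => /(_ isT); rewrite oppr_eq0 mulf_eq0.
    by rewrite [_ * k i == 0]gt_eqF// orbF => /eqP.
  pose t i := 1 - c ord0 i / c ord0 i0.
  have t0 i : 0 <= t i by rewrite subr_ge0 ler_pdivrMr// mul1r.
  exists (fun i => (t i)%:C%C * b i); split; last first.
  - by exists i0; rewrite /t divff ?subrr ?mul0r// gt_eqF.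
  - apply: le_trans bk.
    under eq_bigr => i _.
      rewrite normcM normc_real (ger0_norm (t0 i)) /t -mulrA mulrBl mul1r.
      by rewrite mulrAC; over.
    by rewrite sumrB lerBlDr lerDl -mulr_suml divr_ge0// ltW.
  - rewrite -bX; under eq_bigr => i _.
      rewrite -scalerA /t rmorphB /= scalerBl scale1r mulrC rmorphM /= -scalerA; over.
    by rewrite sumrB -scaler_sumr cX scaler0 subr0.
have [/eqP kA|] := eqVneq (kermx A) 0; last first.
  move=> /rowV0Pn[c cA c0]; apply: (slide c) => //.
  by apply/sub_kermxP.
(* Without such a relation the vectors form a real basis; then i times their
   sum is a real combination of them, and turning each vector accordingly
   lowers the cost. *)
exfalso.
have rfA : row_full A.
  move: kA; rewrite kermx_eq0 /row_free /row_full => /eqP rA.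
  by rewrite eqn_leq rank_leq_col /= rA.
have /submxP[d dA] := submx_full (realify ('i%C *: \sum_i X i)) rfA.
have dX : \sum_i (d ord0 i)%:C%C *: (b i *: X i) = 'i%C *: \sum_i X i.
  by apply: realify_inj; rewrite -realify_sum -dA.
pose D := 1 + \sum_i d ord0 i ^+ 2.
have D1 : 1 <= D by rewrite lerDl sumr_ge0// => i _; rewrite sqr_ge0.
have D0 : 0 < D by apply: lt_le_trans D1.
(* Multiplying the i-th vector by u_i = 1 - e (1 + i d_i) leaves the sum unchanged,
   and |u_i|^2 = (1 - e)^2 + (e d_i)^2 < 1 as soon as e (1 + d_i^2) < 2. *)
pose e := D^-1.
have e0 : 0 < e by rewrite invr_gt0.
pose u i : Cplx R := Complex (1 - e) (- (e * d ord0 i)).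
have u1 i : normc (u i) < 1.
  rewrite -(ltr_pXn2r (n := 2))// ?nnegrE ?normc_ge0// sqr_normcE /= expr1n.
  have eD : e * D = 1 by rewrite mulVf// gt_eqF.
  have dD : d ord0 i ^+ 2 <= D - 1.
    by rewrite /D addrC addKr (bigD1 i)//= lerDl sumr_ge0// => j _; rewrite sqr_ge0.
  have : e * (e * d ord0 i ^+ 2) <= e * (e * (D - 1)) by rewrite !ler_pM2l.
  rewrite (_ : e * (e * (D - 1)) = e * (e * D) - e * e); last by ring.
  rewrite eD; nra.
have relX : \sum_i ((1 + 'i%C * (d ord0 i)%:C%C) * b i) *: X i = 0.
  under eq_bigr do rewrite mulrDl mul1r scalerDl -mulrA -!scalerA.
  by rewrite big_split /= bX -scaler_sumr dX scalerA -expr2 sqr_i scaleN1r subrr.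
have /bmin : \sum_i (u i * b i) *: X i = \sum_i X i.
  rewrite -[RHS]bX -[RHS]subr0 -[X in _ - X](scaler0 _ (e%:C%C : Cplx R)) -[X in _ *: X]relX.
  rewrite scaler_sumr -sumrB; apply: eq_bigr => i _.
  rewrite scalerA -scalerBl; congr (_ *: _).
  rewrite mulrA -{2}[b i]mul1r -mulrBl; congr (_ * _).
  by rewrite /u; simpc.
rewrite leNgt => /negP; apply.
apply: ltr_sum.
  by apply/hasP; exists ord0 => //; rewrite mem_index_enum.
move=> i _; rewrite normcM -mulrA -[ltRHS]mul1r ltr_pM2r//.
Qed.

(** The loss [eps] makes all the weights positive, as [shorten_sum] requires, even
    where [h] vanishes. *)
Lemma drop_summand (R : realType) (n m : nat) (h : 'rV[Cplx R]_n -> R)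
    (X : 'I_m.+1 -> 'rV[Cplx R]_n) (eps : R) :
  (forall Y, 0 <= h Y) -> (forall a Y, h (a *: Y) = normc a * h Y) ->
  (n + n <= m.+1)%N -> 0 < eps ->
  exists Y : 'I_m -> 'rV[Cplx R]_n, \sum_i Y i = \sum_i X i /\
    \sum_i h (Y i) <= \sum_i h (X i) + eps.
Proof.
move=> h0 hZ nm e0.
pose k i := h (X i) + eps / m.+1%:R.
have k0 i : 0 < k i by rewrite ltr_wpDl// divr_gt0.
have [b [bX bk [i0 bi0]]] := shorten_sum X nm k0.
exists (fun i => b (lift i0 i) *: X (lift i0 i)); split.
  by rewrite -bX (bigD1_ord i0)//= bi0 scale0r add0r.
have -> : \sum_i h (X i) + eps = \sum_i k i.
  rewrite big_split /=; congr (_ + _).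
  by rewrite sumr_const card_ord -[RHS]mulr_natr mulfVK.
apply: le_trans bk; rewrite [leRHS](bigD1_ord i0)//= bi0 normc0 mul0r add0r.
apply: ler_sum => i _; rewrite hZ ler_wpM2l ?normc_ge0//.
by rewrite /k lerDl divr_ge0// ltW.
Qed.

Lemma pad_summands (R : realType) (n m M : nat) (h : 'rV[Cplx R]_n -> R)
    (X : 'I_m -> 'rV[Cplx R]_n) : h 0 = 0 -> (m <= M)%N ->
  exists Y : 'I_M -> 'rV[Cplx R]_n, \sum_i Y i = \sum_i X i /\
    \sum_i h (Y i) = \sum_i h (X i).
Proof.
move=> h0 mM.
pose X' (i : nat) := if insub i is Some j then X j else 0.
have X'E (i : 'I_m) : X' i = X i by rewrite /X' valK.
have X'0 i : ~~ (i < m)%N -> X' i = 0 by move=> im; rewrite /X' insubN.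
exists (fun i => X' i); split.
  under [RHS]eq_bigr do rewrite -X'E.
  rewrite (big_ord_widen _ X' mM) [RHS]big_mkcond; apply: eq_bigr => i _.
  by case: ifPn => // /X'0.
under [RHS]eq_bigr do rewrite -X'E.
rewrite (big_ord_widen _ (fun i => h (X' i)) mM) [RHS]big_mkcond; apply: eq_bigr => i _.
by case: ifPn => // /X'0 ->.
Qed.

(** Summands are dropped one at a time while there are at least [2n] of them; halving
    the allowance at each step keeps the total loss below [eps]. *)
Lemma shorten_decomposition (R : realType) (n m : nat) (h : 'rV[Cplx R]_n -> R)
    (X : 'I_m -> 'rV[Cplx R]_n) (eps : R) :
  (forall Y, 0 <= h Y) -> (forall a Y, h (a *: Y) = normc a * h Y) ->
  (0 < n)%N -> 0 < eps ->
  exists Y : 'I_(2 * n - 1) -> 'rV[Cplx R]_n, \sum_i Y i = \sum_i X i /\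
    \sum_i h (Y i) <= \sum_i h (X i) + eps.
Proof.
move=> h0 hZ n0.
have h00 : h 0 = 0 by rewrite -(scale0r 0) hZ normc0 mul0r.
elim: m X eps => [|m IH] X eps e0.
  have [Y [YX hY]] := @pad_summands _ _ _ (2 * n - 1) h X h00 (leq0n _).
  by exists Y; split => //; rewrite hY lerDl ltW.
have [nm|nm] := leqP (n + n) m.+1; last first.
  have [|Y [YX hY]] := @pad_summands _ _ m.+1 (2 * n - 1) h X h00.
    by rewrite mul2n -addnn leq_subRL ?add1n// addn_gt0 n0.
  by exists Y; split => //; rewrite hY lerDl ltW.
have e20 : 0 < eps / 2 by rewrite divr_gt0.
have [Y [YX hY]] := drop_summand X h0 hZ nm e20.
have [Z [ZY hZY]] := IH Y _ e20.
exists Z; split; first by rewrite ZY.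
by rewrite (le_trans hZY)// (le_trans (lerD hY (lexx _)))// -addrA -splitr.
Qed.

(** * The Kobayashi-Buseman metric as a metric of finite order *)

(** Rescaling the vector rescales the admissible factors; if there are none, both
    infima are 0 by convention. The value at 0 comes from the constant disc. *)
Lemma kobayashiZ (R : realType) (n : nat) (D : set 'rV[Cplx R]_n)
    (z : 'rV[Cplx R]_n) (a : Cplx R) (X : 'rV[Cplx R]_n) :
  D z -> kobayashi D z (a *: X) = normc a * kobayashi D z X.
Proof.
move=> Dz.
pose S Y := [set normc a | a in [set a : Cplx R |
  exists f, [/\ holo_disc D f, f 0 = z & a *: (f^`()%classic 0) = Y]]].
have lb Y : has_lbound (S Y) by exists 0 => _ [b _ <-]; exact: normc_ge0.
have [->|a0] := eqVneq a 0.
  rewrite scale0r normc0 mul0r; apply/eqP; rewrite eq_le kobayashi_ge0 andbT.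
  apply: ge_inf; first exact: lb.
  exists 0; last exact: normc0.
  exists (cst z); split => //; last by rewrite scale0r.
have le (b : Cplx R) Y : b != 0 ->
    kobayashi D z (b *: Y) <= normc b * kobayashi D z Y.
  move=> b0; have nb0 : 0 < normc b by rewrite normc_gt0.
  rewrite mulrC -ler_pdivrMr//.
  rewrite -[kobayashi D z Y]/(inf (S Y)) -[kobayashi D z _]/(inf (S (b *: Y))).
  have [S0|/set0P S0] := eqVneq (S Y) set0.
    rewrite S0 inf0 (_ : S (b *: Y) = set0) ?inf0 ?mul0r//.
    rewrite -subset0 => r [c [f [f1 f2 f3]] _].
    suff : S Y (normc (c / b)) by rewrite S0.
    exists (c / b) => //; exists f; split=> //.
    by rewrite mulrC -scalerA f3 scalerA mulVf// scale1r.
  apply: lb_le_inf => // _ [c [f [f1 f2 f3]] <-].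
  rewrite ler_pdivrMr//; apply: ge_inf; first exact: lb.
  exists (b * c); first by exists f; split=> //; rewrite -scalerA f3.
  by rewrite normcM mulrC.
apply/eqP; rewrite eq_le le//=.
rewrite mulrC -ler_pdivlMr ?normc_gt0// mulrC -normcV.
have := le a^-1 (a *: X); rewrite invr_eq0 scalerA mulVf// scale1r; exact.
Qed.

Lemma has_lbound_decompositions (R : realType) (n : nat) (D : set 'rV[Cplx R]_n) m z X :
  has_lbound [set \sum_(j < m) kobayashi D z (Y j) |
    Y in [set Y : 'I_m -> 'rV[Cplx R]_n | \sum_(j < m) Y j = X]].
Proof.
by exists 0 => _ [Y _ <-]; apply: sumr_ge0 => i _; exact: kobayashi_ge0.
Qed.

Lemma decompositions_neq0 (R : realType) (n : nat) (D : set 'rV[Cplx R]_n) m z X :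
  (0 < m)%N ->
  [set \sum_(j < m) kobayashi D z (Y j) |
    Y in [set Y : 'I_m -> 'rV[Cplx R]_n | \sum_(j < m) Y j = X]] !=set0.
Proof.
case: m => // m _; pose Y := fun j : 'I_m.+1 => if j == ord0 then X else 0.
exists (\sum_j kobayashi D z (Y j)); exists Y => //=.
by rewrite -big_mkcond big_pred1_eq.
Qed.

(** A pseudonorm below the Kobayashi metric is subadditive. *)
Lemma buseman_le_order (R : realType) (n : nat) (D : set 'rV[Cplx R]_n) m z X :
  (0 < m)%N -> kobayashi_buseman D z X <= kobayashi_order D m z X.
Proof.
move=> m0; have [[B0 BD BZ] Bk _] := kobayashi_busemanP D z.
apply: lb_le_inf; first exact: decompositions_neq0.
move=> _ [Y <- <-].
apply: (@le_trans _ _ (\sum_j kobayashi_buseman D z (Y j))); last exact: ler_sum.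
apply: (big_ind2 (fun u (x : R) => kobayashi_buseman D z u <= x)) => //.
  by rewrite -(scale0r 0) BZ normc0 mul0r.
by move=> u x v y ux vy; rewrite (le_trans (BD _ _))// lerD.
Qed.

Lemma order_eq_buseman (R : realType) (n : nat) (D : set 'rV[Cplx R]_n) z :
  (0 < n)%N -> D z -> kobayashi_order D (2 * n - 1) z = kobayashi_buseman D z.
Proof.
move=> n0 Dz.
have m0 : (0 < 2 * n - 1)%N by rewrite subn_gt0 mul2n -addnn (leq_add n0 n0).
set q := kobayashi_order D _ z.
have q_le_sum m (Y : 'I_m -> 'rV[Cplx R]_n) : q (\sum_i Y i) <= \sum_i kobayashi D z (Y i).
  apply/ler_addgt0Pr => e e0.
  have [Z [ZY ZeY]] := shorten_decomposition Y (kobayashi_ge0 D z)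
    (fun a X => kobayashiZ a X Dz) n0 e0.
  apply: le_trans ZeY; apply: ge_inf; first exact: has_lbound_decompositions.
  by exists Z.
have near_q X (e : R) : 0 < e -> exists2 Y : 'I_(2 * n - 1) -> 'rV[Cplx R]_n,
    \sum_i Y i = X & \sum_i kobayashi D z (Y i) < q X + e.
  move=> e0; have [|_ [Y YX <-] Ye] := inf_adherent e0 (E := [set \sum_j kobayashi D z (Y j) |
      Y in [set Y : 'I_(2 * n - 1) -> 'rV[Cplx R]_n | \sum_j Y j = X]]).
    by split; [exact: decompositions_neq0|exact: has_lbound_decompositions].
  by exists Y.
have q0 X : 0 <= q X.
  apply: lb_le_inf; first exact: decompositions_neq0.
  by move=> _ [Y _ <-]; apply: sumr_ge0 => i _; exact: kobayashi_ge0.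
have qk X : q X <= kobayashi D z X.
  by have := q_le_sum 1%N (fun=> X); rewrite !big_ord1.
have qle (a : Cplx R) X : q (a *: X) <= normc a * q X.
  apply/ler_addgt0Pr => e e0.
  have e'0 : 0 < e / (1 + normc a) by rewrite divr_gt0// ltr_pwDl// normc_ge0.
  have [Y YX Ye] := near_q X _ e'0.
  have := q_le_sum _ (fun i => a *: Y i); rewrite -scaler_sumr YX.
  move/le_trans; apply.
  under eq_bigr do rewrite kobayashiZ//.
  rewrite -mulr_sumr; apply: (le_trans (ler_wpM2l (normc_ge0 a) (ltW Ye))).
  rewrite mulrDr lerD2l mulrCA -[leRHS]mulr1 ler_pM2l//.
  by rewrite ler_pdivrMr ?mul1r ?lerDr// ltr_pwDl// normc_ge0.
(* The metric of order 2n - 1 is itself a pseudonorm below the Kobayashi metric: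
   for the triangle inequality, concatenate two decompositions and shorten. *)
apply/funext => X; apply/eqP; rewrite eq_le buseman_le_order// andbT.
have [_ _ Bmax] := kobayashi_busemanP D z; apply: Bmax => //; split=> //.
  move=> {}X Y; apply/ler_addgt0Pr => e e0.
  have e20 : 0 < e / 2 by rewrite divr_gt0.
  have [U UX Ue] := near_q X _ e20; have [V VY Ve] := near_q Y _ e20.
  pose W (i : 'I_(2 * n - 1 + (2 * n - 1))) :=
    match fintype.split i with inl j => U j | inr j => V j end.
  have WE : (forall j, W (lshift _ j) = U j) /\ (forall j, W (rshift _ j) = V j).
    by split=> j; rewrite /W; [rewrite (unsplitK (inl j))|rewrite (unsplitK (inr j))].
  have := q_le_sum _ W; rewrite !big_split_ord /=.
  under eq_bigr do rewrite WE.1.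
  under [X in _ + X]eq_bigr do rewrite WE.2.
  under [X in _ <= X + _]eq_bigr do rewrite WE.1.
  under [X in _ <= _ + X]eq_bigr do rewrite WE.2.
  rewrite UX VY => /le_trans; apply.
  by rewrite (le_trans (lerD (ltW Ue) (ltW Ve)))// addrACA -splitr.
move=> a {}X; apply/eqP; rewrite eq_le qle /=.
have [->|a0] := eqVneq a 0; first by rewrite normc0 mul0r.
rewrite mulrC -ler_pdivlMr ?normc_gt0// mulrC -normcV.
by have := qle a^-1 (a *: X); rewrite scalerA mulVf// scale1r.
Qed.

(** * Divergence-free fields without continuous derivatives *)

(** The intervals of each coordinate are nested with lengths tending to 0, and the
    supremum of the left ends lies in all of them. *)
Lemma nested_rectangles (R : realType) (T : nat -> R -> R -> Prop) (L M a c : R) :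
  (forall k x y, T k x y -> exists x' y', [/\ T k.+1 x' y',
     x <= x' /\ x' + L / 2 ^+ k.+1 <= x + L / 2 ^+ k &
     y <= y' /\ y' + M / 2 ^+ k.+1 <= y + M / 2 ^+ k]) ->
  0 <= L -> 0 <= M -> T 0%N a c ->
  exists x0 y0, forall k, exists x y, [/\ T k x y,
    x <= x0 <= x + L / 2 ^+ k & y <= y0 <= y + M / 2 ^+ k].
Proof.
move=> step L0 M0 T0.
have /choice[nxt nxtP] : forall u : nat * (R * R), exists v : R * R,
    T u.1 u.2.1 u.2.2 -> [/\ T u.1.+1 v.1 v.2,
     u.2.1 <= v.1 /\ v.1 + L / 2 ^+ u.1.+1 <= u.2.1 + L / 2 ^+ u.1 &
     u.2.2 <= v.2 /\ v.2 + M / 2 ^+ u.1.+1 <= u.2.2 + M / 2 ^+ u.1].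
  move=> [k [x y]] /=; have [/step[x' [y' ?]]|nT] := pselect (T k x y).
    by exists (x', y').
  by exists (x, y).
(* Lower left corners of the successive rectangles. *)
pose p := fix p k := if k is k'.+1 then nxt (k', p k') else (a, c).
have pT k : T k (p k).1 (p k).2.
  by elim: k => //= k /(nxtP (k, p k))[].
have limit (u : nat -> R) (N : R) : 0 <= N ->
    (forall k, u k <= u k.+1 /\ u k.+1 + N / 2 ^+ k.+1 <= u k + N / 2 ^+ k) ->
    exists x, forall k, u k <= x <= u k + N / 2 ^+ k.
  move=> N0 uN.
  have N2 k : 0 <= N / 2 ^+ k by rewrite divr_ge0// exprn_ge0.
  have incr i j : u i <= u (j + i)%N.
    by elim: j => //= j /le_trans; apply; exact: (uN _).1.
  have decr i j : u (j + i)%N + N / 2 ^+ (j + i) <= u i + N / 2 ^+ i.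
    by elim: j => //= j; apply: le_trans; exact: (uN _).2.
  have ub k : ubound (range u) (u k + N / 2 ^+ k).
    move=> _ [j _ <-]; have [jk|/ltnW kj] := leqP j k.
      by rewrite -(subnK jk); apply: le_trans (incr j (k - j)%N) _; rewrite lerDl.
    by rewrite -(subnK kj); apply: le_trans (decr k (j - k)%N); rewrite lerDl.
  exists (sup (range u)) => k; apply/andP; split.
    by apply: ub_le_sup; [exists (u 0%N + N / 2 ^+ 0); exact: ub|exists k].
  by apply: ge_sup; [exists (u 0%N), 0%N|exact: ub].
have [x0 x0P] := limit (fun k => (p k).1) L L0 (fun k =>
  let: And3 _ h _ := nxtP (k, p k) (pT k) in h).
have [y0 y0P] := limit (fun k => (p k).2) M M0 (fun k =>
  let: And3 _ _ h := nxtP (k, p k) (pT k) in h).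
by exists x0, y0 => k; exists (p k).1, (p k).2.
Qed.

(** Every estimate of an integral below is one of the increment of a primitive,
    through this form of the mean value theorem. *)
Lemma increment_bound (R : realType) (f df : R -> R) (a b M : R) : a <= b ->
  (forall x, a <= x <= b -> is_derive x 1 f (df x)) ->
  (forall x, a <= x <= b -> `|df x| <= M) -> `|f b - f a| <= M * (b - a).
Proof.
move=> ab fdf dfM.
have [||x] := @MVT_segment R f df a b ab.
- by move=> x; rewrite in_itv /= => /andP[ax xb]; apply: fdf; rewrite !ltW.
- apply: derivable_within_continuous => x; rewrite in_itv /= => xab.
  by have := fdf _ xab.
rewrite in_itv /= => xab ->; rewrite normrM [`|b - a|]ger0_norm ?subr_ge0//.
by rewrite ler_wpM2r ?subr_ge0// dfM.
Qed.

(** If [F s] is a primitive of [P s] for each [s], this is the difference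
    of the integrals of [P b] and [P a] over the interval from [c] to [d]. *)
Definition corners (R : realType) (F : R -> R -> R) (a b c d : R) : R :=
  (F b d - F b c) - (F a d - F a c).

(** An affine field with [P_s = Q_t = p] contributes [p * h * l] to both terms, which
    cancel; only the errors of the affine approximation are left. *)
Lemma corners_affine (R : realType) (P Q F G : R -> R -> R) (x y h l x0 y0 : R)
    (P0 Q0 p p' q e : R) : 0 <= h -> 0 <= l ->
  (forall s t, x <= s <= x + h -> y <= t <= y + l ->
    [/\ is_derive t 1 (F s) (P s t), is_derive s 1 (G^~ t) (Q s t),
        `|P s t - P0 - (p * (s - x0) + p' * (t - y0))| <= e &
        `|Q s t - Q0 - (q * (s - x0) + p * (t - y0))| <= e]) ->
  `|corners F x (x + h) y (y + l) - corners G x (x + h) y (y + l)|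
    <= 2 * e * (h + l).
Proof.
move=> h0 l0 H.
have xh : x <= x + h <= x + h by rewrite lexx lerDl h0.
have yl : y <= y + l <= y + l by rewrite lexx lerDl l0.
have xx : x <= x <= x + h by rewrite lexx lerDl h0.
have yy : y <= y <= y + l by rewrite lexx lerDl l0.
have linear (c t : R) : is_derive t 1 (fun t => c * t) c.
  by have := is_deriveZ c (is_derive_id t 1); rewrite [_ *: _]mulr1.
have Fgap : `|corners F x (x + h) y (y + l) - p * h * l| <= 2 * e * l.
  have := @increment_bound R (fun t => F (x + h) t - F x t - p * h * t)
     (fun t => P (x + h) t - P x t - p * h) y (y + l) (2 * e).
  rewrite (_ : y + l - y = l); last by ring.
  rewrite (_ : (F (x + h) (y + l) - F x (y + l) - p * h * (y + l)
     - (F (x + h) y - F x y - p * h * y)) = corners F x (x + h) y (y + l) - p * h * l);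
     last by rewrite /corners; ring.
  apply=> [|t yt|t yt]; first by rewrite lerDl.
    have [d1 _ _ _] := H _ _ xh yt; have [d2 _ _ _] := H _ _ xx yt.
    exact: (is_deriveB (is_deriveB d1 d2) (linear (p * h) t)).
  have [_ _ P1 _] := H _ _ xh yt; have [_ _ P2 _] := H _ _ xx yt.
  clear - P1 P2; move: P1 P2; rewrite !ler_norml; lra.
have Ggap : `|corners G x (x + h) y (y + l) - p * h * l| <= 2 * e * h.
  have := @increment_bound R (fun t => G t (y + l) - G t y - p * l * t)
     (fun t => Q t (y + l) - Q t y - p * l) x (x + h) (2 * e).
  rewrite (_ : x + h - x = h); last by ring.
  rewrite (_ : (G (x + h) (y + l) - G (x + h) y - p * l * (x + h)
     - (G x (y + l) - G x y - p * l * x)) = corners G x (x + h) y (y + l) - p * h * l);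
     last by rewrite /corners; ring.
  apply=> [|t yt|t yt]; first by rewrite lerDl.
    have [_ d1 _ _] := H _ _ yt yl; have [_ d2 _ _] := H _ _ yt yy.
    exact: (is_deriveB (is_deriveB d1 d2) (linear (p * l) t)).
  have [_ _ _ P1] := H _ _ yt yl; have [_ _ _ P2] := H _ _ yt yy.
  clear - P1 P2; move: P1 P2; rewrite !ler_norml; lra.
move: Fgap Ggap; set u := corners _ _ _ _ _; set v := corners _ _ _ _ _.
clear; rewrite !ler_norml; lra.
Qed.

(** The flux of the field [(P, - Q)] through the boundary of a rectangle vanishes if
    its divergence [P_s - Q_t] vanishes at every point. As in
    Goursat's lemma the derivatives may be discontinuous, hence the bisection. The
    integrals over the sides enter through the primitives [F] and [G]. *)
Lemma corners_flux0 (R : realType) (P Q F G : R -> R -> R) (a b c d : R) :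
  a <= b -> c <= d ->
  (forall s t, a <= s <= b -> c <= t <= d -> is_derive t 1 (F s) (P s t)) ->
  (forall s t, a <= s <= b -> c <= t <= d -> is_derive s 1 (G^~ t) (Q s t)) ->
  (forall s t, a <= s <= b -> c <= t <= d -> exists p p' q,
    forall e, 0 < e -> exists2 del, 0 < del &
    forall s' t', a <= s' <= b -> c <= t' <= d ->
      `|s' - s| < del -> `|t' - t| < del ->
      `|P s' t' - P s t - (p * (s' - s) + p' * (t' - t))|
        <= e * (`|s' - s| + `|t' - t|) /\
      `|Q s' t' - Q s t - (q * (s' - s) + p * (t' - t))|
        <= e * (`|s' - s| + `|t' - t|)) ->
  corners F a b c d = corners G a b c d.
Proof.
move=> ab cd FP GQ PQ.
pose L := b - a; pose M := d - c.
have L0 : 0 <= L by rewrite subr_ge0.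
have M0 : 0 <= M by rewrite subr_ge0.
pose gap x y h l := corners F x (x + h) y (y + l) - corners G x (x + h) y (y + l).
apply/eqP; rewrite -subr_eq0.
have -> : corners F a b c d - corners G a b c d = gap a c L M.
  by rewrite /gap /L /M !(addrC _ (_ - _)) !subrK.
(* Goursat's bisection: if the gap K is nonzero, one quarter of each rectangle
   keeps at least a quarter of the gap. *)
apply/negPn/negP => gap0; pose K := `|gap a c L M|.
have K0 : 0 < K by rewrite normr_gt0.
pose T k x y := [/\ a <= x /\ x + L / 2 ^+ k <= b, c <= y /\ y + M / 2 ^+ k <= d &
  K / 4 ^+ k <= `|gap x y (L / 2 ^+ k) (M / 2 ^+ k)|].
have half N k : N / 2 ^+ k = N / 2 ^+ k.+1 + N / 2 ^+ k.+1 :> R.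
  by rewrite exprS; field; rewrite expf_neq0.
have [|//|//||x0 [y0 xy0]] := @nested_rectangles R T L M a c.
- move=> k x y [[ax xb] [cy yd] KT].
  set h := L / 2 ^+ k.+1; set l := M / 2 ^+ k.+1.
  have h0 : 0 <= h by rewrite divr_ge0// exprn_ge0.
  have l0 : 0 <= l by rewrite divr_ge0// exprn_ge0.
  rewrite (half L) (half M) -/h -/l in xb yd KT *.
  have gapD : gap x y (h + h) (l + l) = gap x y h l + gap (x + h) y h l
      + gap x (y + l) h l + gap (x + h) (y + l) h l.
    by rewrite /gap /corners !addrA; ring.
  have K4 : K / 4 ^+ k = 4 * (K / 4 ^+ k.+1) by rewrite exprS; field; rewrite expf_neq0.
  have [x' [y' [x'P y'P gK]]] : exists x' y', [/\ x' = x \/ x' = x + h,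
      y' = y \/ y' = y + l & K / 4 ^+ k.+1 <= `|gap x' y' h l|].
    apply: contrapT => no.
    have no' x' y' : x' = x \/ x' = x + h -> y' = y \/ y' = y + l ->
        `|gap x' y' h l| < K / 4 ^+ k.+1.
      move=> ? ?; rewrite ltNge; apply/negP => ?; apply: no.
      by exists x', y'.
    have := no' x y (or_introl erefl) (or_introl erefl).
    have := no' (x + h) y (or_intror erefl) (or_introl erefl).
    have := no' x (y + l) (or_introl erefl) (or_intror erefl).
    have := no' (x + h) (y + l) (or_intror erefl) (or_intror erefl).
    move: KT; rewrite gapD K4.
    set u1 := gap _ _ _ _; set u2 := gap _ _ _ _; set u3 := gap _ _ _ _; set u4 := gap _ _ _ _.
    have := ler_normD (u1 + u2 + u3) u4; have := ler_normD (u1 + u2) u3.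
    have := ler_normD u1 u2; lra.
  exists x', y'; split; last 2 first.
  + by case: x'P => ->; split; lra.
  + by case: y'P => ->; split; lra.
  rewrite /T -/h -/l; split=> //; first by case: x'P => ->; split; lra.
  by case: y'P => ->; split; lra.
- have aL : a + L = b by rewrite /L addrC subrK.
  have cM : c + M = d by rewrite /M addrC subrK.
  by rewrite /T !expr0 !divr1 aL cM; split.
have [x [y [[[ax xb] [cy yd] _] /andP[xx0 x0x] /andP[yy0 y0y]]]] := xy0 0%N.
have /PQ PQ0 : a <= x0 <= b by apply/andP; split; lra.
have /PQ0[p [p' [q pq]]] : c <= y0 <= d by apply/andP; split; lra.
(* Near the limit point both fields are affine up to e times the distance, so
   the gap is at most 2 e (h + l)^2: too small a fraction of the area. *)
pose C := 1 + (L + M).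
have C1 : 1 <= C by rewrite lerDl addr_ge0.
have C0 : 0 < C by apply: lt_le_trans C1.
pose e := K / (4 * C ^+ 2).
have e0 : 0 < e by rewrite divr_gt0// mulr_gt0// exprn_gt0.
have [del del0 {}pq] := pq _ e0.
have [k kdel] : exists k, C / 2 ^+ k < del.
  exists (Num.bound (C / del)); rewrite ltr_pdivrMr ?exprn_gt0// mulrC -ltr_pdivrMr//.
  apply: lt_trans (archi_boundP _) _; first by rewrite divr_ge0// ltW.
  by rewrite -natrX ltr_nat ltn_expl.
move: {x y ax xb cy yd xx0 x0x yy0 y0y} (xy0 k) => [x [y [[[ax xb] [cy yd] Kgap] Xx Yy]]].
move: xb yd Kgap Xx Yy; set h := L / 2 ^+ k; set l := M / 2 ^+ k.
move=> xb yd Kgap /andP[xx0 x0x] /andP[yy0 y0y].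
have h0 : 0 <= h by rewrite divr_ge0// exprn_ge0.
have l0 : 0 <= l by rewrite divr_ge0// exprn_ge0.
have hldel : h + l < del.
  apply: le_lt_trans kdel; rewrite -mulrDl ler_wpM2r// ?invr_ge0 ?exprn_ge0//.
  by rewrite /C lerDr.
have gaphl : `|gap x y h l| <= 2 * e * (h + l) ^+ 2.
  rewrite exprS expr1 (mulrA (2 * e)) -(mulrA 2).
  apply: (@corners_affine _ P Q _ _ _ _ _ _ x0 y0 (P x0 y0) (Q x0 y0) p p' q) => //.
  move=> s t /andP[xs sx] /andP[yt ty].
  have sab : a <= s <= b by rewrite (le_trans ax xs) (le_trans sx xb).
  have tcd : c <= t <= d by rewrite (le_trans cy yt) (le_trans ty yd).
  have sh : `|s - x0| <= h.
    by clear - xx0 x0x xs sx; rewrite ler_norml; lra.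
  have tl : `|t - y0| <= l.
    by clear - yy0 y0y yt ty; rewrite ler_norml; lra.
  have [//|//|||P1 Q1] := pq s t.
  - by apply: le_lt_trans hldel; rewrite (le_trans sh)// lerDl.
  - by apply: le_lt_trans hldel; rewrite (le_trans tl)// lerDr.
  split; [exact: FP|exact: GQ|apply: le_trans P1 _|apply: le_trans Q1 _].
    by rewrite ler_pM2l// lerD.
  by rewrite ler_pM2l// lerD.
have hl2 : (h + l) ^+ 2 <= C ^+ 2 / 4 ^+ k.
  rewrite (_ : 4 ^+ k = (2 ^+ k) ^+ 2 :> R); last by rewrite -exprM mulnC exprM; congr (_ ^+ _); ring.
  rewrite -expr_div_n ler_pXn2r ?nnegrE ?addr_ge0//.
    by rewrite -mulrDl ler_wpM2r// ?invr_ge0 ?exprn_ge0// /C lerDr.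
  by rewrite divr_ge0// ?exprn_ge0// ltW.
have e20 : 0 <= 2 * e by rewrite mulr_ge0// ltW.
have := le_trans Kgap (le_trans gaphl (ler_wpM2l e20 hl2)).
rewrite mulrA ler_pM2r ?invr_gt0 ?exprn_gt0//.
have -> : 2 * e * C ^+ 2 = K / 2 by rewrite /e; field; rewrite gt_eqF.
lra.
Qed.

(** * Circle means of holomorphic functions *)

Lemma derivable_expansion (K : numFieldType) (f : K -> K) (x : K) :
  derivable f x 1 -> forall e : K, 0 < e -> exists2 d : K, 0 < d &
  forall h, `|h| < d -> `|f (x + h) - f x - 'D_1 f x * h| <= e * `|h|.
Proof.
move=> fx e e0; have /cvgrPdist_lt/(_ _ e0) := fx.
move=> /nbhs_ballP[d /= d0 dP]; exists d => // h hd.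
have [->|h0] := eqVneq h 0.
  by rewrite addr0 subrr mulr0 subr0 normr0 mulr0.
have := dP h; rewrite /ball /= sub0r normrN => /(_ hd h0).
rewrite [h *: 1]mulr1 -[h^-1 *: _]/(h^-1 * _) (addrC h) => /ltW D.
rewrite (_ : _ - _ = - (h * ('D_1 f x - h^-1 * (f (x + h) - f x)))); last first.
  by rewrite mulrBr mulrA divff// mul1r; ring.
by rewrite normrN normrM mulrC ler_wpM2r.
Qed.

Lemma derivable_expansionC (R : realType) (f : Cplx R -> Cplx R) (x : Cplx R) :
  derivable f x 1 -> forall e : R, 0 < e -> exists2 d : R, 0 < d &
  forall h, normc h < d ->
    normc (f (x + h) - f x - ('D_1 f x : Cplx R) * h) <= e * normc h.
Proof.
move=> fx e e0; have e0' : 0 < (e%:C%C : Cplx R) by rewrite ltcR.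
have [d d0 dP] := derivable_expansion fx e0'.
have := d0; rewrite ltcE /= => /andP[/eqP di dr].
exists (complex.Re d) => // h hd.
have := dP h; rewrite -lecR rmorphM /=; apply.
by rewrite ltcE /= di eqxx.
Qed.

(** The point with polar coordinates [expR s] and [t], i.e. the complex exponential of
    [s + i t]. *)
Definition polar (R : realType) (s t : R) : Cplx R :=
  Complex (expR s * cos t) (expR s * sin t).

Lemma normc_polar (R : realType) (s t : R) : normc (polar s t) = expR s.
Proof.
rewrite /= !exprMn -mulrDr cos2Dsin2 mulr1 sqrtr_sqr gtr0_norm//.
exact: expR_gt0.
Qed.

Lemma polarD (R : realType) (s t u v : R) :
  polar (s + u) (t + v) = polar s t * polar u v.
Proof.
rewrite /polar expRD sinD cosD; apply/eqP; rewrite eq_complex /=.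
by apply/andP; split; apply/eqP; ring.
Qed.

(** The complex exponential has derivative 1 at 0. *)
Lemma polar_expansion (R : realType) (e : R) : 0 < e -> exists2 d : R, 0 < d &
  forall u v, `|u| < d -> `|v| < d ->
    normc (polar u v - 1 - Complex u v : Cplx R) <= e * (`|u| + `|v|).
Proof.
move=> e0; have [e1 [e10 e11 e1e]] : exists e1 : R, [/\ 0 < e1, e1 <= 1 & 6 * e1 <= e].
  exists (Num.min 1 (e / 6)); rewrite lt_min ltr01 divr_gt0// ge_min lexx; split=> //.
  by rewrite -ler_pdivlMl// mulrC ge_min lexx orbT.
have [d1 d10 exp1] := derivable_expansion (@derivable_expR R 0) e10.
have [d2 d20 cos1] := derivable_expansion (@derivable_cos R 0) e10.
have [d3 d30 sin1] := derivable_expansion (@derivable_sin R 0) e10.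
exists (Num.min e1 (Num.min d1 (Num.min d2 d3))).
  by rewrite !lt_min e10 d10 d20 d30.
move=> u v; rewrite !lt_min => /and4P[ue u1 u2 u3] /and4P[ve v1 v2 v3].
move: (exp1 _ u1) (cos1 _ v2) (sin1 _ v3).
rewrite !derive_val !add0r expR0 cos0 sin0 subr0 oppr0 mul0r subr0 !mul1r.
set a := expR u - 1 - u; set b := cos v - 1; set s := sin v - v => ha hb hs.
have nu := normr_ge0 u; have nv := normr_ge0 v.
have hu : `|expR u| <= 3.
  rewrite (_ : expR u = a + u + 1); last by rewrite /a; ring.
  apply: le_trans (ler_normD _ _) _; rewrite normr1.
  have := ler_normD a u; nra.
have hu1 : `|expR u - 1| <= 2 * `|u|.
  rewrite (_ : expR u - 1 = a + u); last by rewrite /a; ring.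
  apply: le_trans (ler_normD _ _) _; nra.
apply: le_trans (normc_le_ReIm _) _.
have -> : complex.Re (polar u v - 1 - Complex u v) = a + expR u * b.
  by rewrite /a /b /=; ring.
have -> : complex.Im (polar u v - 1 - Complex u v) = expR u * s + (expR u - 1) * v.
  by rewrite /s /=; ring.
have := ler_normD a (expR u * b); have := ler_normD (expR u * s) ((expR u - 1) * v).
rewrite !normrM.
have p1 : `|expR u| * `|b| <= 3 * (e1 * `|v|) by rewrite ler_pM.
have p2 : `|expR u| * `|s| <= 3 * (e1 * `|v|) by rewrite ler_pM.
have p3 : `|expR u - 1| * `|v| <= 2 * `|u| * e1 by rewrite ler_pM// ltW.
have p4 : 6 * e1 * (`|u| + `|v|) <= e * (`|u| + `|v|) by rewrite ler_wpM2r// addr_ge0.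
have p5 : 0 <= e1 * `|u| by rewrite mulr_ge0// ltW.
lra.
Qed.

(** The chain rule for the composition with the complex exponential: in logarithmic
    polar coordinates a holomorphic function is still complex differentiable. *)
Lemma polar_comp_expansion (R : realType) (k : Cplx R -> Cplx R) (s t : R) :
  expR s <= 1 -> derivable k (polar s t) 1 ->
  exists A : Cplx R, forall e : R, 0 < e -> exists2 d : R, 0 < d &
  forall s' t', `|s' - s| < d -> `|t' - t| < d ->
    normc (k (polar s' t') - k (polar s t) - A * Complex (s' - s) (t' - t))
      <= e * (`|s' - s| + `|t' - t|).
Proof.
move=> s1 dk; set w := polar s t in dk *; pose l : Cplx R := 'D_1 k w.
have nw : normc w <= 1 by rewrite normc_polar.
exists (l * w) => e e0.
have nl := normc_ge0 l.
have e20 : 0 < e / (2 * (1 + normc l)) by rewrite divr_gt0// mulr_gt0// ltr_pwDl.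
have [d1 d10 exp1] := derivable_expansionC dk (divr_gt0 e0 (ltr0n _ 4)).
have [d2 d20 exp2] := polar_expansion e20.
have [d3 d30 exp3] := polar_expansion (@ltr01 R).
exists (Num.min (d1 / 4) (Num.min d2 d3)).
  by rewrite !lt_min d20 d30 divr_gt0.
move=> s' t'; rewrite !lt_min => /and3P[u1 u2 u3] /and3P[v1 v2 v3].
set u := s' - s in u1 u2 u3 *; set v := t' - t in v1 v2 v3 *.
have -> : polar s' t' = w * polar u v.
  by rewrite -polarD /u /v !(addrC _ (_ - _)) !subrK.
pose E := polar u v - 1; pose uv : Cplx R := Complex u v.
have nuv : normc uv <= `|u| + `|v| by exact: normc_le_ReIm.
have nE : normc E <= 2 * (`|u| + `|v|).
  rewrite (_ : E = (E - uv) + uv); last by rewrite subrK.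
  apply: le_trans (le_normcD _ _) _; have := exp3 _ _ u3 v3; rewrite -/E -/uv; lra.
have nh : normc (w * E) <= 2 * (`|u| + `|v|).
  by rewrite normcM; apply: le_trans nE; rewrite ler_piMl// normc_ge0.
have hd1 : normc (w * E) < d1.
  apply: le_lt_trans nh _.
  by move: u1 v1; rewrite !ltr_pdivlMr//; lra.
(* First-order errors of k at w, and of the exponential at 0. *)
have -> : k (w * polar u v) - k w - l * w * uv =
    (k (w + w * E) - k w - l * (w * E)) + l * w * (E - uv).
  have -> : w + w * E = w * polar u v by rewrite /E; ring.
  by ring.
apply: le_trans (le_normcD _ _) _.
have p1 := exp1 _ hd1.
have p2 : e / 4 * normc (w * E) <= e / 4 * (2 * (`|u| + `|v|)).
  by rewrite ler_wpM2l// divr_ge0// ltW.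
have p3 : normc (l * w * (E - uv)) <= e / 2 * (`|u| + `|v|).
  rewrite !normcM.
  have uv0 : 0 <= `|u| + `|v| by rewrite addr_ge0.
  have q1 := exp2 _ _ u2 v2; rewrite -/E -/uv in q1.
  have q2 : normc l * normc w <= 1 + normc l.
    apply: (@le_trans _ _ (normc l)); last by rewrite lerDr.
    by rewrite ler_piMr.
  apply: (le_trans (ler_pM _ _ q2 q1)); rewrite ?mulr_ge0 ?normc_ge0//.
  rewrite le_eqVlt; apply/orP; left; apply/eqP; field.
  by rewrite gt_eqF// ltr_pwDl.
rewrite -/l; lra.
Qed.

Lemma exists_primitive (R : realType) (f : R -> R) (lo hi : R) :
  (forall x, lo <= x <= hi -> {for x, continuous f}) ->
  exists F : R -> R, forall x, lo < x < hi -> is_derive x 1 F (f x).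
Proof.
move=> cf.
exists (fun x => (\int[@lebesgue_measure R]_(t in [set` `[lo, x]]) f t)%R).
move=> x /andP[lox xhi].
have [] := @continuous_FTC1_closed R f lo x hi xhi _ lox; last 2 first.
- by apply: cf; rewrite !ltW.
- by move=> dF <-; rewrite derive1E; exact: derivableP.
apply: continuous_compact_integrable; first exact: segment_compact.
apply: continuous_in_subspaceT => y; rewrite inE /= in_itv /=; exact: cf.
Qed.

Lemma continuous_of_increment (R : realType) (f : R -> R) (x p d : R) : 0 < d ->
  (forall y, `|y - x| < d -> `|f y - f x - p * (y - x)| <= `|y - x|) ->
  {for x, continuous f}.
Proof.
move=> d0 fd; apply/cvgrPdist_lt => e e0; apply/nbhs_ballP.
exists (Num.min d (e / (1 + `|p|))); first by rewrite /= lt_min d0 divr_gt0// ltr_pwDl.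
move=> y; rewrite /ball /= distrC lt_min => /andP[yd ye].
have Y := fd _ yd; rewrite distrC.
rewrite ltr_pdivlMr ?ltr_pwDl// in ye.
rewrite (_ : f y - f x = (f y - f x - p * (y - x)) + p * (y - x)); last by ring.
apply: le_lt_trans (ler_normD _ _) _; rewrite normrM.
nra.
Qed.

(** In logarithmic polar coordinates the function [k] has vanishing flux through the
    rectangle with sides [a <= s <= b] and [0 <= t <= 2 pi], and by periodicity the two
    sides [t = 0] and [t = 2 pi] cancel. Hence the mean of [k] over the circle of radius
    [expR s] does not depend on [s]; it tends to [c] as [s] tends to minus infinity, and
    is bounded by [C] at [s = b]. *)
Lemma circle_mean_Re (R : realType) (k : Cplx R -> Cplx R) (c : Cplx R) (b C : R) :
  (forall w, w != 0 -> normc w < 1 -> derivable k w 1) ->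
  (forall e : R, 0 < e -> exists2 r : R, 0 < r &
    forall w, w != 0 -> normc w < r -> normc (k w - c) <= e) ->
  b < 0 -> (forall t, normc (k (polar b t)) <= C) ->
  complex.Re c <= C.
Proof.
move=> dk kc b0 kC; apply/ler_addgt0Pr => e e0.
have [r r0 kr] := kc _ e0.
pose a := Num.min (b - 1) (ln r - 1).
have ab : a < b by rewrite gt_min ltrBlDr ltrDl ltr01.
have ar : expR a < r.
  by rewrite -[ltRHS](lnK r0) ltr_expR gt_min orbC ltrBlDr ltrDl ltr01.
pose T : R := pi *+ 2.
have T0 : 0 < T by rewrite mulrn_wgt0// pi_gt0.
have polar0 s t : polar s t != 0 :> Cplx R.
  by rewrite -normc_gt0 normc_polar expR_gt0.
pose P s t := complex.Re (k (polar s t)); pose Q s t := complex.Im (k (polar s t)).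
(* The Cauchy-Riemann equation P_s = Q_t, in first-order form. *)
have PQ s t : s < 0 -> exists p p' q, forall e, 0 < e -> exists2 del, 0 < del &
    forall s' t', `|s' - s| < del -> `|t' - t| < del ->
      `|P s' t' - P s t - (p * (s' - s) + p' * (t' - t))|
        <= e * (`|s' - s| + `|t' - t|) /\
      `|Q s' t' - Q s t - (q * (s' - s) + p * (t' - t))|
        <= e * (`|s' - s| + `|t' - t|).
  move=> s0; have s1 : expR s < 1 by rewrite -expR0 ltr_expR.
  have [|A AP] := @polar_comp_expansion R k s t (ltW s1).
    by apply: dk; rewrite ?normc_polar.
  exists (complex.Re A), (- complex.Im A), (complex.Im A) => e' /AP[del del0 delP].
  exists del => // s' t' s's t't; have D := delP _ _ s's t't.
  split; apply: le_trans D.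
    apply: le_trans (Re_le_normc _); rewrite !ReB.
    by case: A {AP delP} => x y /=; rewrite mulNr.
  apply: le_trans (Im_le_normc _); rewrite !ImB.
  by case: A {AP delP} => x y /=; rewrite [x * _ + _]addrC.
have Pc s t : s < 0 -> {for t, continuous (P s)}.
  move=> /(PQ s t)[p [p' [q /(_ _ ltr01)[del del0 delP]]]].
  apply: (@continuous_of_increment _ _ _ p' del del0) => t' t't.
  have [|P1 _] := delP s t' _ t't; first by rewrite subrr normr0.
  by move: P1; rewrite subrr mulr0 add0r normr0 add0r mul1r.
have Qc s t : s < 0 -> {for s, continuous (Q^~ t)}.
  move=> /(PQ s t)[p [p' [q /(_ _ ltr01)[del del0 delP]]]].
  apply: (@continuous_of_increment _ _ _ q del del0) => s' s's.
  have [|_ Q1] := delP s' t s's; first by rewrite subrr normr0.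
  by move: Q1; rewrite subrr mulr0 addr0 normr0 addr0 mul1r.
(* The domains of the primitives are widened because a primitive is
   differentiated only at interior points. *)
have /choice[F FP] : forall s, exists F : R -> R, s < 0 ->
    forall t, -1 < t < T + 1 -> is_derive t 1 F (P s t).
  move=> s; have [s0|_] := ltP s 0; last by exists 0.
  by have [F FP] := @exists_primitive R (P s) (-1) (T + 1) (fun t _ => Pc s t s0); exists F.
have b20 : b / 2 < 0 by rewrite pmulr_llt0.
have /choice[G GP] : forall t, exists G : R -> R,
    forall s, a - 1 < s < b / 2 -> is_derive s 1 G (Q s t).
  move=> t; apply: exists_primitive => s /andP[_ sb].
  by apply: Qc; apply: le_lt_trans b20.
have flux : corners F a b 0 T = corners (fun s t => G t s) a b 0 T.
  apply: (@corners_flux0 R P Q) => //; try exact: ltW.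
  - move=> s t /andP[_ sb] /andP[t0 tT]; apply: FP; first exact: le_lt_trans b0.
    by apply/andP; split; lra.
  - by move=> s t /andP[sa sb] _; apply: GP; apply/andP; split; lra.
  - move=> s t /andP[_ sb] _; have /(PQ s t)[p [p' [q pq]]] : s < 0 by lra.
    exists p, p', q => e' /pq[del del0 delP]; exists del => // s' t' _ _; exact: delP.
(* The two horizontal sides of the rectangle have the same image, so their
   contributions cancel and the means over the circles of radii e^a and e^b
   agree. *)
have QT s : Q s T = Q s 0.
  by rewrite /Q /polar /T cos2pi sin2pi cos0 sin0.
have G0 : corners (fun s t => G t s) a b 0 T = 0.
  apply/eqP; rewrite -normr_le0.
  have := @increment_bound R (fun s => G T s - G 0 s) (fun s => Q s T - Q s 0) a b 0.
  rewrite mul0r (_ : corners _ _ _ _ _ = G T b - G 0 b - (G T a - G 0 a))//.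
  apply=> [|s /andP[sa sb]|s _]; first exact: ltW.
    by apply: is_deriveB; apply: GP; apply/andP; split; lra.
  by rewrite QT subrr normr0.
have Fab : F b T - F b 0 = F a T - F a 0.
  by apply/eqP; rewrite -subr_eq0 -[X in X == _]/(corners F a b 0 T) flux G0.
have Fb : `|F b T - F b 0| <= C * (T - 0).
  apply: (@increment_bound _ _ (P b)); first exact: ltW.
    by move=> t /andP[t0 tT]; apply: FP => //; apply/andP; split; lra.
  by move=> t _; apply: le_trans (kC t); exact: Re_le_normc.
have Fa : `|F a T - F a 0 - complex.Re c * T| <= e * (T - 0).
  have := @increment_bound R (fun t => F a t - complex.Re c * t)
    (fun t => P a t - complex.Re c) 0 T e.
  rewrite (_ : F a T - _ - (F a 0 - _) = F a T - F a 0 - complex.Re c * T); last by ring.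
  apply=> [|t /andP[t0 tT]|t _]; first exact: ltW.
    apply: is_deriveB; first by apply: FP; [exact: lt_trans b0|apply/andP; split; lra].
    by have := is_deriveZ (complex.Re c) (is_derive_id t 1); rewrite [_ *: _]mulr1.
  rewrite -ReB; apply: le_trans (Re_le_normc _) _.
  by apply: kr; rewrite ?normc_polar.
move: Fa Fb; rewrite Fab subr0 !ler_norml => /andP[Fa _] /andP[_ Fb].
by rewrite -(ler_pM2r T0) mulrDl; lra.
Qed.

(** A Schwarz lemma of order [p]: for [k w = g w / w ^ p] the hypothesis is a bound
    of [g] on the disc. The circle means of [k] are at most [M / r ^ p], and [r] tends
    to 1. *)
Lemma punctured_disc_bound (R : realType) (k : Cplx R -> Cplx R) (c : Cplx R)
    (p : nat) (M : R) :
  (forall w, w != 0 -> normc w < 1 -> derivable k w 1) ->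
  (forall e : R, 0 < e -> exists2 r : R, 0 < r &
    forall w, w != 0 -> normc w < r -> normc (k w - c) <= e) ->
  (forall w, w != 0 -> normc w < 1 -> normc (k w) * normc w ^+ p <= M) ->
  normc c <= M.
Proof.
move=> dk kc kM.
have [u nu uc] := unimodular_phase c.
have bound b : b < 0 -> normc c <= M * expR (- (p%:R * b)).
  move=> b0; have -> : normc c = complex.Re (u * c) by rewrite uc.
  apply: (@circle_mean_Re R (fun w => u * k w) (u * c) b).
  - by move=> w w0 w1; apply: derivableM; [exact: derivable_cst|exact: dk].
  - move=> e /kc[r r0 kr]; exists r => // w w0 wr.
    by rewrite -mulrBr normcM nu mul1r kr.
  - exact: b0.
  - move=> t; rewrite normcM nu mul1r expRN ler_pdivlMr ?expR_gt0// expRM_natl.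
    rewrite -(normc_polar b t); apply: kM; last by rewrite normc_polar -expR0 ltr_expR.
    by rewrite -normc_gt0 normc_polar expR_gt0.
have M0 : 0 <= M.
  have := bound (-1) (ltrN10 R); have := normc_ge0 c => h1 h2.
  by have := le_trans h1 h2; rewrite pmulr_lge0// expR_gt0.
apply/ler_addgt0Pr => e e0.
(* Let b tend to 0 from below. *)
have [d d0 exp1] := derivable_expansion (@derivable_expR R 0) ltr01.
pose x := Num.min (d / 2) (e / (2 * (1 + M))).
have x0 : 0 < x by rewrite lt_min !divr_gt0// mulr_gt0// ltr_pwDl.
have xd : `|x| < d by rewrite gtr0_norm// gt_min; apply/orP; left; lra.
have xe : M * (2 * x) <= e.
  have : x <= e / (2 * (1 + M)) by rewrite ge_min lexx orbT.
  by rewrite ler_pdivlMr ?mulr_gt0 ?ltr_pwDl//; nra.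
have := bound (- (x / (1 + p%:R))); rewrite oppr_lt0 divr_gt0 ?ltr_pwDl//.
move=> /(_ isT)/le_trans; apply.
have : expR (- (p%:R * - (x / (1 + p%:R)))) <= expR x.
  rewrite ler_expR mulrN opprK mulrCA ler_piMr ?(ltW x0)//.
  by rewrite ler_pdivrMr ?ltr_pwDl// mul1r lerDr.
have := exp1 _ xd; rewrite derive_val !add0r expR0 !mul1r (gtr0_norm x0) ler_norml.
by move=> /andP[_ h1] h2; nra.
Qed.

(** * The Kobayashi metric of the cubic domain at the origin *)

(** The function whose strict sublevel set is the domain. It is homogeneous of degree
    3, so that the Kobayashi metric at the origin is its normalised cube root. *)
Definition cubic_gauge (R : realType) (k : nat) (z : 'rV[Cplx R]_k.+1) : R :=
  \sum_(j < k.+1 | j != ord0)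
      (2 * normc (z ord0 ord0 ^+ 3 - z ord0 j ^+ 3)
       + normc (z ord0 ord0 ^+ 3 + z ord0 j ^+ 3)).

Lemma cubic_gaugeZ (R : realType) (k : nat) (a : Cplx R) (z : 'rV[Cplx R]_k.+1) :
  cubic_gauge (a *: z) = normc a ^+ 3 * cubic_gauge z.
Proof.
rewrite /cubic_gauge mulr_sumr; apply: eq_bigr => j _.
rewrite !mxE !exprMn -mulrBr -mulrDr !(normcM (a ^+ 3)) normcX; ring.
Qed.

Lemma cubic_gauge_ge0 (R : realType) (k : nat) (z : 'rV[Cplx R]_k.+1) :
  0 <= cubic_gauge z.
Proof. by apply: sumr_ge0 => j _; rewrite addr_ge0 ?mulr_ge0 ?normc_ge0. Qed.

Lemma is_derive_scale (K : numFieldType) (V : normedModType K) (z : V) (w : K) :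
  is_derive w 1 (fun h : K => h *: z) z.
Proof.
have D : (fun h : K => h^-1 *: (((fun h : K => h *: z) \o shift w) (h *: 1)
    - w *: z)) @ 0^' --> z.
  apply: cvg_near_cst; near=> h.
  rewrite /= [h *: 1]mulr1 scalerDl addrK scalerA mulVf ?scale1r//.
  by near: h; exact: nbhs_dnbhs_neq.
by apply: DeriveDef; [by apply/cvg_ex; exists z|exact: cvg_lim D].
Unshelve. all: by end_near. Qed.

Lemma cubic_form_cvg (K : numFieldType) (n : nat) (P : pred 'I_n) (i0 : 'I_n)
    (u v a : 'I_n -> K) (g : 'I_n -> K -> K) :
  (forall j, g j w @[w --> 0^'] --> a j) ->
  (fun w => \sum_(j < n | P j) (u j * (g i0 w ^+ 3 - g j w ^+ 3)
    + v j * (g i0 w ^+ 3 + g j w ^+ 3))) w @[w --> 0^'] -->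
  \sum_(j < n | P j) (u j * (a i0 ^+ 3 - a j ^+ 3) + v j * (a i0 ^+ 3 + a j ^+ 3)).
Proof.
move=> ga; have g3 j : g j w ^+ 3 @[w --> 0^'] --> a j ^+ 3.
  by rewrite exprS; under eq_fun do rewrite exprS; apply: cvgM => //; apply: cvgM.
apply: cvg_big => [|j _]; first exact: add_continuous.
by apply: cvgD; apply: cvgM; first [exact: cvg_cst|exact: cvgB|exact: cvgD].
Qed.

Lemma dnbhs_cvg_expansion (K : numFieldType) (f : K -> K) (l : K) :
  f w @[w --> 0^'] --> l -> forall e : K, 0 < e -> exists2 d : K, 0 < d &
  forall w, w != 0 -> `|w| < d -> `|f w - l| <= e.
Proof.
move=> fl e e0; have /cvgrPdist_lt/(_ _ e0) := fl.
move=> /nbhs_ballP[d /= d0 dP]; exists d => // w w0 wd.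
have := dP w; rewrite /ball /= sub0r normrN => /(_ wd w0) /ltW.
by rewrite distrC.
Qed.

Lemma derivative_coord_cvg (K : numFieldType) (n : nat) (f : K -> 'rV[K]_n) (j : 'I_n) :
  derivable f 0 1 -> f 0 = 0 ->
  (f w ord0 j / w) @[w --> 0^'] --> (f^`()%classic 0) ord0 j.
Proof.
move=> df f0; rewrite derive1E.
have df' : (fun h : K => h^-1 *: (f (h *: 1 + 0) - f 0)) @ 0^' --> 'D_1 f 0 by exact: df.
have := cvg_comp _ _ df' (@coord_continuous K 1 n ord0 j ('D_1 f 0)).
apply: cvg_trans; apply: near_eq_cvg; near=> w.
by rewrite /= f0 subr0 addr0 [w *: 1]mulr1 mxE mulrC.
Unshelve. all: by end_near. Qed.

Lemma derivable_coord (K : numFieldType) (n : nat) (f : K -> 'rV[K]_n) (j : 'I_n) (w : K) :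
  derivable f w 1 -> derivable (fun x => f x ord0 j : K) w 1.
Proof.
move=> /cvg_ex[l fl]; apply/cvg_ex; exists (l ord0 j).
have := cvg_comp _ _ fl (@coord_continuous K 1 n ord0 j l).
apply: cvg_trans; apply: near_eq_cvg; near=> h.
by rewrite /= !mxE.
Unshelve. all: by end_near. Qed.

Lemma derivable_cubic_form (K : numFieldType) (n : nat) (P : pred 'I_n) (i0 : 'I_n)
    (u v : 'I_n -> K) (g : 'I_n -> K -> K) (w : K) :
  (forall j, derivable (g j) w 1) ->
  derivable (fun w => \sum_(j < n | P j) (u j * (g i0 w ^+ 3 - g j w ^+ 3)
    + v j * (g i0 w ^+ 3 + g j w ^+ 3))) w 1.
Proof.
move=> dg; have d3 j : derivable (fun w => g j w ^+ 3) w 1.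
  rewrite (_ : (fun w => _) = (fun w => g j w * (g j w * g j w))); last first.
    by apply/funext => x; rewrite !exprS mulr1.
  by apply: derivableM; [exact: dg|apply: derivableM; exact: dg].
rewrite (_ : (fun w => _) = \sum_(j < n) (fun w => if P j then
   (u j * (g i0 w ^+ 3 - g j w ^+ 3) + v j * (g i0 w ^+ 3 + g j w ^+ 3)) else 0)).
  apply: derivable_sum => j; case: (P j) => /=; last exact: derivable_cst.
  have dc (c : K) := @derivable_cst K K K c w 1.
  have d1 := derivableM (dc (u j)) (derivableB (d3 i0) (d3 j)).
  have d2 := derivableM (dc (v j)) (derivableD (d3 i0) (d3 j)).
  exact: (derivableD d1 d2).
by apply/funext => x; rewrite fct_sumE big_mkcond.
Qed.

(** The gauge is the largest modulus of the cubic forms obtained by giving its terms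
    phases. For the phases that are optimal at the vector [f' 0], the form composed with
    [f] is bounded by [2 k] on the disc and vanishes to order 3 at 0, with leading
    coefficient the gauge of [f' 0]. *)
Lemma cubic_gauge_derivative (R : realType) (k : nat) (f : Cplx R -> 'rV[Cplx R]_k.+1) :
  holo_disc (@cubic_domain R k) f -> f 0 = 0 ->
  cubic_gauge (f^`()%classic 0) <= 2 * k%:R.
Proof.
move=> fD f0; set a := f^`()%classic 0.
have disc0 : @unit_disc R 0 by rewrite /unit_disc /mkset normc0 ltr01.
have /choice[u uP] : forall j, exists u : Cplx R, normc u = 1 /\
    u * (a ord0 ord0 ^+ 3 - a ord0 j ^+ 3)
      = (normc (a ord0 ord0 ^+ 3 - a ord0 j ^+ 3))%:C%C.
  by move=> j; have [u ? ?] := unimodular_phase (a ord0 ord0 ^+ 3 - a ord0 j ^+ 3); exists u.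
have /choice[v vP] : forall j, exists v : Cplx R, normc v = 1 /\
    v * (a ord0 ord0 ^+ 3 + a ord0 j ^+ 3)
      = (normc (a ord0 ord0 ^+ 3 + a ord0 j ^+ 3))%:C%C.
  by move=> j; have [v ? ?] := unimodular_phase (a ord0 ord0 ^+ 3 + a ord0 j ^+ 3); exists v.
(* With these phases the form is bounded by the gauge everywhere, and equals it
   at the derivative. *)
pose form (z : 'I_k.+1 -> Cplx R) : Cplx R := \sum_(j < k.+1 | j != ord0)
  (2%:R * u j * (z ord0 ^+ 3 - z j ^+ 3) + v j * (z ord0 ^+ 3 + z j ^+ 3)).
have form_le (z : 'rV[Cplx R]_k.+1) : normc (form (fun j => z ord0 j)) <= cubic_gauge z.
  apply: le_trans (normc_sum _ _ _) _; apply: ler_sum => j _.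
  apply: le_trans (le_normcD _ _) _; rewrite !normcM (uP j).1 (vP j).1 mulr1 mul1r.
  have -> : (2%:R : Cplx R) = (2%:R : R)%:C%C by rewrite rmorph_nat.
  by rewrite normc_real ger0_norm.
have formZ (w : Cplx R) (z : 'I_k.+1 -> Cplx R) :
    form (fun j => w * z j) = w ^+ 3 * form z.
  by rewrite /form mulr_sumr; apply: eq_bigr => j _; rewrite !exprMn; ring.
have forma : form (fun j => a ord0 j) = (cubic_gauge a)%:C%C.
  rewrite /form /cubic_gauge rmorph_sum; apply: eq_bigr => j _.
  rewrite -mulrA (uP j).2 (vP j).2 rmorphD rmorphM /=; congr (_ * _ + _).
  by rewrite rmorph_nat.
rewrite -[cubic_gauge a]ger0_norm ?cubic_gauge_ge0// -normc_real -forma.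
pose g j (w : Cplx R) : Cplx R := f w ord0 j / w.
have gZ (w : Cplx R) : w != 0 ->
    form (fun j => g j w) * w ^+ 3 = form (fun j => f w ord0 j).
  move=> w0; rewrite mulrC -formZ /form.
  have gw j : w * g j w = f w ord0 j by rewrite /g mulrCA divff// mulr1.
  by apply: eq_bigr => j _; rewrite !gw.
apply: (@punctured_disc_bound R (fun w => form (fun j => g j w)) _ 3).
- move=> w w0 w1; apply: derivable_cubic_form => j.
  apply: derivableM; first by apply: derivable_coord; exact: (fD w w1).1.
  by apply: derivableV => //; exact: derivable_id.
- have lim : (fun w => form (fun j => g j w)) w @[w --> 0^'] --> form (fun j => a ord0 j).
    apply: cubic_form_cvg => j; apply: derivative_coord_cvg => //.
    exact: (fD 0 disc0).1.
  move=> e e0; have e0' : 0 < (e%:C%C : Cplx R) by rewrite ltcR.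
  have [d d0 dP] := dnbhs_cvg_expansion lim e0'.
  have := d0; rewrite ltcE /= => /andP[/eqP di dr].
  exists (complex.Re d) => // w w0 wd.
  have := dP w w0; rewrite -lecR; apply.
  by rewrite ltcE /= di eqxx.
- move=> w w0 w1; rewrite -normcX -normcM gZ//.
  by apply: le_trans (form_le _) _; apply: ltW; exact: (fD w w1).2.
Qed.

(** The disc [w |-> w *: z] stays in the domain by homogeneity. *)
Lemma kobayashi_cubic_le1 (R : realType) (k : nat) (z : 'rV[Cplx R]_k.+1) :
  (0 < k)%N -> cubic_gauge z <= 2 * k%:R -> kobayashi (@cubic_domain R k) 0 z <= 1.
Proof.
move=> k0 zk; apply: ge_inf.
  by exists 0 => _ [a _ <-]; exact: normc_ge0.
exists 1; last exact: normc1.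
exists (fun w => w *: z); split; last 2 first.
- by rewrite scale0r.
- by rewrite scale1r derive1E; exact: (@derive_val _ _ _ _ _ _ _ (is_derive_scale z 0)).
move=> w w1; split; first exact: (@ex_derive _ _ _ _ _ _ _ (is_derive_scale z w)).
rewrite /cubic_domain /= -/(cubic_gauge _) cubic_gaugeZ.
apply: (@le_lt_trans _ _ (normc w ^+ 3 * (2 * k%:R))).
  by rewrite ler_wpM2l// exprn_ge0// normc_ge0.
rewrite gtr_pMl ?mulr_gt0 ?ltr0n//.
by rewrite exprn_ilt1// normc_ge0.
Qed.

Lemma kobayashi_cubic_lt (R : realType) (k : nat) (X : 'rV[Cplx R]_k.+1) (t : R) :
  (0 < k)%N -> kobayashi (@cubic_domain R k) 0 X < t ->
  exists b y, [/\ X = b *: y, normc b < t & cubic_gauge y <= 2 * k%:R].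
Proof.
move=> k0 /inf_lt[|_ [b [f [fD f0 fX]] <-] bt]; last first.
  by exists b, (f^`()%classic 0); split=> //; exact: cubic_gauge_derivative.
(* The set defining the metric is nonempty, for otherwise its infimum would be
   the default value 0: a small enough multiple of X lies in the domain. *)
pose r : R := 1 + cubic_gauge X.
have r1 : 1 <= r by rewrite lerDl cubic_gauge_ge0.
have r0 : 0 < r by apply: lt_le_trans r1.
have rC0 : (r%:C%C : Cplx R) != 0.
  by rewrite -normc_eq0 normc_real normr_eq0 gt_eqF.
exists (normc (r%:C%C : Cplx R)), r%:C%C => //.
exists (fun w => w *: (r%:C%C^-1 *: X)); split; last 2 first.
- by rewrite scale0r.
- rewrite derive1E (@derive_val _ _ _ _ _ _ _ (is_derive_scale _ 0)).
  by rewrite scalerA divff// scale1r.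
move=> w w1; split; first exact: (@ex_derive _ _ _ _ _ _ _ (is_derive_scale _ w)).
rewrite /cubic_domain /= -/(cubic_gauge _) !cubic_gaugeZ normcV normc_real gtr0_norm//.
have X0 := cubic_gauge_ge0 X.
apply: (@le_lt_trans _ _ (1 * (r^-1 ^+ 3 * cubic_gauge X))).
  apply: ler_wpM2r; first by rewrite mulr_ge0// exprn_ge0// invr_ge0 ltW.
  by rewrite exprn_ile1 ?normc_ge0// ltW.
rewrite mul1r.
apply: (@lt_le_trans _ _ 1); last by rewrite -natrM ler1n muln_gt0.
rewrite exprVn mulrC ltr_pdivrMr ?exprn_gt0// mul1r.
apply: (@lt_le_trans _ _ r); first by rewrite /r ltrDr.
by rewrite ler_eXnr.
Qed.

(** * Shortest decompositions in the cubic domain *)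

(** Since [2 |a| <= |a - b| + |a + b|]. The sum on the left measures how far [z] is from
    the extremal vectors of the linear form [z |-> z ord0 ord0]. *)
Lemma cubic_gauge_le (R : realType) (k : nat) (z : 'rV[Cplx R]_k.+1) :
  2 * k%:R * normc (z ord0 ord0) ^+ 3 +
  \sum_(j < k.+1 | j != ord0) normc (z ord0 ord0 ^+ 3 - z ord0 j ^+ 3)
  <= cubic_gauge z.
Proof.
have -> : 2 * k%:R * normc (z ord0 ord0) ^+ 3 =
    \sum_(j < k.+1 | j != ord0) 2 * normc (z ord0 ord0) ^+ 3.
  rewrite big_mkcond big_ord_recl /= add0r sumr_const card_ord -mulr_natr; ring.
rewrite -big_split; apply: ler_sum => j _ /=.
rewrite -normcX; set a := _ ^+ 3; set b := _ ^+ 3.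
have := le_normcD (a - b) (a + b).
rewrite (_ : a - b + (a + b) = 2%:R * a); last by ring.
have -> : (2%:R : Cplx R) = (2%:R : R)%:C%C by rewrite rmorph_nat.
rewrite normcM normc_real ger0_norm//; lra.
Qed.

Lemma cubic_gauge_coord0 (R : realType) (k : nat) (z : 'rV[Cplx R]_k.+1) :
  (0 < k)%N -> cubic_gauge z <= 2 * k%:R -> normc (z ord0 ord0) <= 1.
Proof.
move=> k0 zk; have := le_trans (cubic_gauge_le z) zk.
have : 0 <= \sum_(j < k.+1 | j != ord0) normc (z ord0 ord0 ^+ 3 - z ord0 j ^+ 3).
  by apply: sumr_ge0 => j _; exact: normc_ge0.
move=> s0 h; have : 2 * k%:R * normc (z ord0 ord0) ^+ 3 <= 2 * k%:R by lra.
rewrite ger_pMr ?mulr_gt0 ?ltr0n//.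
by rewrite expr_le1// normc_ge0.
Qed.

(** On the face where the first coordinate has modulus 1, only the vectors whose
    coordinates have equal cubes are left. *)
Lemma cubic_gauge_extremal (R : realType) (k : nat) (z : 'rV[Cplx R]_k.+1) j :
  cubic_gauge z <= 2 * k%:R -> normc (z ord0 ord0) = 1 -> z ord0 j ^+ 3 = z ord0 ord0 ^+ 3.
Proof.
move=> zk z1; have [->//|j0] := eqVneq j ord0.
have := le_trans (cubic_gauge_le z) zk; rewrite z1 expr1n mulr1 gerDl => s0.
have : \sum_(j < k.+1 | j != ord0) normc (z ord0 ord0 ^+ 3 - z ord0 j ^+ 3) == 0.
  by rewrite eq_le s0 sumr_ge0// => i _; exact: normc_ge0.
rewrite psumr_eq0 => [/allP/(_ j)|i _]; last exact: normc_ge0.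
by rewrite mem_index_enum j0 normc_eq0 subr_eq0 => /(_ isT)/eqP.
Qed.

Lemma cubic_gauge_coord (R : realType) (k : nat) (z : 'rV[Cplx R]_k.+1) j :
  (0 < k)%N -> cubic_gauge z <= 2 * k%:R -> normc (z ord0 j) <= 2 * k%:R + 1.
Proof.
move=> k0 zk; have z0 := cubic_gauge_coord0 k0 zk.
have k1 : (1 : R) <= k%:R by rewrite ler1n.
have [->|j0] := eqVneq j ord0; first by lra.
have : normc (z ord0 ord0 ^+ 3 - z ord0 j ^+ 3) <= 2 * k%:R.
  apply: le_trans zk; apply: le_trans (cubic_gauge_le z).
  rewrite (bigD1 j)//= addrCA lerDl addr_ge0//.
    by rewrite !mulr_ge0 ?exprn_ge0 ?normc_ge0.
  by apply: sumr_ge0 => i _; exact: normc_ge0.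
move=> d; have : normc (z ord0 j ^+ 3) <= 2 * k%:R + 1.
  rewrite (_ : z ord0 j ^+ 3 = z ord0 ord0 ^+ 3 - (z ord0 ord0 ^+ 3 - z ord0 j ^+ 3)); last by ring.
  apply: le_trans (le_normcD _ _) _; rewrite normcN normcX addrC lerD//.
  by rewrite exprn_ile1 ?normc_ge0.
rewrite normcX; have [le1 _|lt1] := leP (normc (z ord0 j)) 1; first by lra.
by apply: le_trans; rewrite ler_eXnr// ltW.
Qed.

(** The infimum over decompositions is attained: by [cubic_gauge_coord] the
    factors and vectors vary in a compact set. Splitting each summand into a
    factor [b i] and a vector [y i] of bounded gauge reduces the matter to the continuity
    of the gauge. *)
Lemma attained_decomposition (R : realType) (k m : nat) (X : 'rV[Cplx R]_k.+1) (T : R) :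
  (0 < k)%N -> (0 < m)%N -> kobayashi_order (@cubic_domain R k) m 0 X <= T ->
  exists (b : 'I_m -> Cplx R) (y : 'I_m -> 'rV[Cplx R]_k.+1),
    [/\ X = \sum_i b i *: y i, \sum_i normc (b i) <= T &
        forall i, cubic_gauge (y i) <= 2 * k%:R].
Proof.
move=> k0 m0 XT.
have approx (e : R) : 0 < e -> exists (b : 'I_m -> Cplx R) (y : 'I_m -> 'rV[Cplx R]_k.+1),
    [/\ X = \sum_i b i *: y i, \sum_i normc (b i) <= T + e &
        forall i, cubic_gauge (y i) <= 2 * k%:R].
  move=> e0; pose e' := e / 2 / m%:R.
  have e'0 : 0 < e' by rewrite !divr_gt0// ltr0n.
  have e20 : 0 < e / 2 by rewrite divr_gt0.
  have [|_ [Y YX <-] Ye] := inf_adherent e20 (E := [set \sum_j kobayashi (@cubic_domain R k) 0 (Y j) |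
      Y in [set Y : 'I_m -> 'rV[Cplx R]_k.+1 | \sum_j Y j = X]]).
    by split; [exact: decompositions_neq0|exact: has_lbound_decompositions].
  have /choice[b bP] : forall i, exists b : Cplx R, exists y, [/\ Y i = b *: y,
      normc b < kobayashi (@cubic_domain R k) 0 (Y i) + e' & cubic_gauge y <= 2 * k%:R].
    by move=> i; apply: kobayashi_cubic_lt => //; rewrite ltrDl.
  have {bP}/choice[y yP] := bP.
  exists b, y; split; last by move=> i; have [] := yP i.
    by rewrite -YX; apply: eq_bigr => i _; have [] := yP i.
  apply: (@le_trans _ _ (\sum_i (kobayashi (@cubic_domain R k) 0 (Y i) + e'))).
    by apply: ler_sum => i _; have [_ /ltW] := yP i.
  rewrite big_split /= sumr_const card_ord -mulr_natr /e' divfK ?pnatr_eq0 -?lt0n//.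
  move: Ye; rewrite -/(kobayashi_order _ _ _ _) => Ye; lra.
(* Coefficients and vectors are stored together in one long row. *)
pose N := #|{: 'I_m * option 'I_k.+1}|.
pose bb (v : 'rV[Cplx R]_N) (i : 'I_m) := v ord0 (enum_rank (i, None)).
pose yy (v : 'rV[Cplx R]_N) (i : 'I_m) : 'rV[Cplx R]_k.+1 :=
  \row_j v ord0 (enum_rank (i, Some j)).
pose pos (x : R) := x + `|x|.
have pos0 x : (pos x == 0) = (x <= 0).
  rewrite /pos; have [x0|x0] := leP x 0; first by rewrite ler0_norm// subrr eqxx.
  by rewrite gtr0_norm// gt_eqF// addr_gt0.
have pos_ge0 x : 0 <= pos x by rewrite /pos -lerBlDl sub0r lerNl; exact: lerNnormlW.
(* A continuous measure of the failure of the three conditions. *)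
pose fail (v : 'rV[Cplx R]_N) : R :=
  \sum_(j < k.+1) normc (\sum_i bb v i * yy v i ord0 j - X ord0 j) +
  (\sum_i pos (cubic_gauge (yy v i) - 2 * k%:R) + pos (\sum_i normc (bb v i) - T)).
pose M := 2 * k%:R + 2 + `|T| : R.
pose A := [set v : 'rV[Cplx R]_N | forall i, square M (v ord0 i)].
have enc (b : 'I_m -> Cplx R) (y : 'I_m -> 'rV[Cplx R]_k.+1) :
    exists v, (forall i, bb v i = b i) /\ (forall i, yy v i = y i).
  exists (\row_l let: (i, o) := enum_val l in if o is Some j then y i ord0 j else b i).
  split=> i; first by rewrite /bb mxE enum_rankK.
  by apply/rowP => j; rewrite !mxE enum_rankK.
have cc l : continuous (fun v : 'rV[Cplx R]_N => v ord0 l) by exact: coord_continuous.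
have cy i j : continuous (fun v => yy v i ord0 j).
  have -> : (fun v => yy v i ord0 j) = (fun v => v ord0 (enum_rank (i, Some j))).
    by apply/funext => v; rewrite mxE.
  exact: cc.
have cy3 i j : continuous (fun v => yy v i ord0 j ^+ 3).
  have -> : (fun v => yy v i ord0 j ^+ 3) =
      (fun v => yy v i ord0 j * (yy v i ord0 j * yy v i ord0 j)).
    by apply/funext => v; rewrite !exprS mulr1.
  by apply: continuous_mul => //; exact: continuous_mul.
have cpos (f : 'rV[Cplx R]_N -> R) : continuous f -> continuous (fun v => pos (f v)).
  by move=> cf; apply: continuous_add => //; exact: continuous_normr.
have cfail : continuous fail.
  apply: continuous_add; [|apply: continuous_add].
  - apply: continuous_sum => j _; apply: continuous_normc; apply: continuous_sub.
      by apply: (@continuous_sum _ _ (Cplx R)) => i _; apply: continuous_mul => //; exact: cc.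
    exact: cst_continuous.
  - apply: continuous_sum => i _; apply: cpos; apply: continuous_sub.
      apply: continuous_sum => j _; apply: continuous_add.
        apply: continuous_mul; first exact: cst_continuous.
        by apply: continuous_normc; exact: continuous_sub.
      by apply: continuous_normc; exact: continuous_add.
    exact: cst_continuous.
  - apply: cpos; apply: continuous_sub; last exact: cst_continuous.
    by apply: continuous_sum => i _; apply: continuous_normc; exact: cc.
have near (e : R) : 0 < e <= 1 -> exists2 v, A v & fail v <= 2 * e.
  move=> /andP[e0 e1]; have [b [y [bX bT yk]]] := approx _ e0.
  have [v [vb vy]] := enc b y.
  have inM (z : Cplx R) : normc z <= M -> square M z.
    by move=> zM; split; apply: le_trans zM; [exact: Re_le_normc|exact: Im_le_normc].
  exists v.
    move=> l; apply: inM; rewrite -[l]enum_valK; case: (enum_val l) => i [j|].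
      have -> : v ord0 (enum_rank (i, Some j)) = y i ord0 j by rewrite -vy mxE.
      apply: le_trans (cubic_gauge_coord j k0 (yk i)) _.
      by have := normr_ge0 T; rewrite /M; lra.
    have -> : v ord0 (enum_rank (i, None)) = b i by rewrite -vb.
    apply: (@le_trans _ _ (T + e)).
      apply: le_trans bT; rewrite (bigD1 i)//= lerDl sumr_ge0// => ? _; exact: normc_ge0.
    have := ler_norm T; have : (0 : R) <= k%:R by []; rewrite /M; lra.
  rewrite /fail big1 => [|j _]; last first.
    apply/eqP; rewrite normc_eq0 subr_eq0 bX summxE; apply/eqP/eq_bigr => i _.
    by rewrite vb vy mxE.
  rewrite big1 => [|i _]; last by apply/eqP; rewrite pos0 vy subr_le0.
  rewrite !add0r; under eq_bigr do rewrite vb.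
  set s := \sum_i _ in bT *; rewrite /pos.
  have [sT|sT] := leP 0 (s - T); first by rewrite ger0_norm//; lra.
  by rewrite ltr0_norm// subrr mulr_ge0// ltW.
have [|v /[1!inE] vA vmin] := compact_EVT_min _ (@compact_squares R M N) (continuous_subspaceT cfail).
  by have [v Av _] := near 1 (introT andP (conj ltr01 (lexx 1))); exists v.
have sum_normc_ge0 u : 0 <= \sum_(j < k.+1) normc (\sum_i bb u i * yy u i ord0 j - X ord0 j).
  by apply: sumr_ge0 => j _; exact: normc_ge0.
have sum_pos_ge0 u : 0 <= \sum_i pos (cubic_gauge (yy u i) - 2 * k%:R).
  by apply: sumr_ge0 => i _; exact: pos_ge0.
have fail_ge0 u : 0 <= fail u.
  exact: (addr_ge0 (sum_normc_ge0 u) (addr_ge0 (sum_pos_ge0 u) (pos_ge0 _))).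
have : fail v == 0.
  rewrite eq_le fail_ge0 andbT leNgt; apply/negP => fv.
  pose e := Num.min 1 (fail v / 4).
  have e0 : 0 < e by rewrite lt_min ltr01 divr_gt0.
  have [|u uA ue] := near e; first by rewrite e0 ge_min lexx.
  have := vmin u; rewrite inE => /(_ uA).
  have : e <= fail v / 4 by rewrite ge_min lexx orbT.
  lra.
rewrite /fail paddr_eq0//; last exact: (addr_ge0 (sum_pos_ge0 v) (pos_ge0 _)).
move=> /andP[/eqP f1]; rewrite paddr_eq0// => /andP[f2].
rewrite pos0 subr_le0 => f3; exists (bb v), (yy v); split=> //.
  apply/rowP => j; rewrite summxE; apply/esym/eqP.
  move/eqP: f1; rewrite psumr_eq0 => [/allP/(_ j)|? _]; last exact: normc_ge0.
  rewrite mem_index_enum normc_eq0 subr_eq0 => /(_ isT)/eqP <-.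
  by apply/eqP/eq_bigr => i _; rewrite mxE.
move=> i; move: f2; rewrite psumr_eq0// => /allP/(_ i).
by rewrite mem_index_enum pos0 subr_le0; exact.
Qed.

(** * A vector that needs many summands *)

(** The two primitive cube roots of unity. *)
Definition omega (R : realType) (sg : bool) : Cplx R :=
  Complex (- (1 / 2)) ((-1) ^+ sg * (Num.sqrt 3 / 2)).

Lemma sqrt3_sqr (R : realType) : Num.sqrt 3 ^+ 2 = 3 :> R.
Proof. by rewrite sqr_sqrtr. Qed.

Lemma omega_sum (R : realType) : omega R true + omega R false = -1.
Proof. by apply/eqP; rewrite eq_complex /=; apply/andP; split; apply/eqP; field. Qed.

Lemma omega_prod (R : realType) : omega R true * omega R false = 1.
Proof.
have h := sqrt3_sqr R; apply/eqP; rewrite eq_complex /=.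
apply/andP; split; apply/eqP; last by field.
rewrite expr1 expr0 (_ : _ - _ = 1 / 4 + Num.sqrt 3 ^+ 2 / 4); last by field.
by rewrite h; field.
Qed.

Lemma cube_root_unity (R : realType) (z : Cplx R) :
  (z ^+ 3 == 1) = [|| z == 1, z == omega R true | z == omega R false].
Proof.
rewrite -subr_eq0 (_ : z ^+ 3 - 1 = (z - 1) * ((z - omega R true) * (z - omega R false))).
  by rewrite !mulf_eq0 !subr_eq0.
have -> : (z - omega R true) * (z - omega R false) =
  z ^+ 2 - (omega R true + omega R false) * z + omega R true * omega R false by ring.
by rewrite omega_sum omega_prod; ring.
Qed.

Lemma omega_cube (R : realType) sg : omega R sg ^+ 3 = 1.
Proof. by apply/eqP; rewrite cube_root_unity; case: sg; rewrite eqxx ?orbT. Qed.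

(** For [x0 = 1], the barycentric coordinate at the vertex [omega sg] of a point of the
    triangle of the cube roots of unity. The argument [x0] makes it a real linear form. *)
Definition bary (R : realType) (sg : bool) (x0 z : Cplx R) : R :=
  (complex.Re x0 - complex.Re z) / 3 + (-1) ^+ sg * (complex.Im z / Num.sqrt 3).

Lemma bary1 (R : realType) sg : bary sg (1 : Cplx R) 1 = 0.
Proof. by rewrite /bary /= subrr mul0r mul0r mulr0 addr0. Qed.

Lemma bary_omega (R : realType) sg sg' :
  bary sg (1 : Cplx R) (omega R sg') = (sg == sg')%:R.
Proof.
have s0 : Num.sqrt 3 != 0 :> R by rewrite gt_eqF// sqrtr_gt0.
by case: sg; case: sg'; rewrite /bary /= ?expr0 ?expr1; field.
Qed.

Lemma omega_neq1 (R : realType) sg : omega R sg != 1.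
Proof.
apply/eqP => o1; have := bary_omega R sg sg; rewrite o1 bary1 eqxx => /eqP.
by rewrite eq_sym oner_eq0.
Qed.

Lemma omega_eq (R : realType) sg sg' : (omega R sg == omega R sg') = (sg == sg').
Proof.
apply/eqP/eqP => [eo|-> //].
apply/eqP; have := bary_omega R sg sg.
by rewrite {1}eo bary_omega eqxx; case: eqP => // _ /eqP; rewrite eq_sym oner_eq0.
Qed.

(** Affinely independent extremal vectors. *)
Definition vertex (R : realType) (k : nat) (i : option ('I_k * bool)) : 'rV[Cplx R]_k.+1 :=
  \row_j if i is Some (l, sg) then if j == lift ord0 l then omega R sg else 1 else 1.

Lemma cubic_gauge_vertex (R : realType) (k : nat) (i : option ('I_k * bool)) :
  cubic_gauge (@vertex R k i) = 2 * k%:R.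
Proof.
have v3 j : @vertex R k i ord0 j ^+ 3 = 1.
  rewrite mxE; case: i => [[l sg]|]; last by rewrite expr1n.
  by case: ifP; rewrite ?omega_cube ?expr1n.
have n2 : normc (1 + 1 : Cplx R) = 2.
  have -> : (1 + 1 : Cplx R) = (2%:R : R)%:C%C by rewrite rmorph_nat.
  by rewrite normc_real ger0_norm.
rewrite /cubic_gauge; under eq_bigr do rewrite !v3 subrr normc0 mulr0 add0r n2.
by rewrite big_mkcond big_ord_recl /= add0r sumr_const card_ord mulr_natr.
Qed.

(** Real linear coordinates in which the extremal vectors with first coordinate 1 have
    entries 0 and 1. *)
Definition coords (R : realType) (k : nat) (X : 'rV[Cplx R]_k.+1) (i : option ('I_k * bool)) : R :=
  if i is Some (l, sg) then bary sg (X ord0 ord0) (X ord0 (lift ord0 l))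
  else complex.Re (X ord0 ord0).

Lemma coords_sum (R : realType) (k : nat) (I : finType) (c : I -> R)
    (v : I -> 'rV[Cplx R]_k.+1) i :
  coords (\sum_j (c j)%:C%C *: v j) i = \sum_j c j * coords (v j) i.
Proof.
have reE l : complex.Re ((\sum_j (c j)%:C%C *: v j) ord0 l) = \sum_j c j * complex.Re (v j ord0 l).
  by rewrite summxE Re_sum; apply: eq_bigr => j _; rewrite mxE ReZ.
have imE l : complex.Im ((\sum_j (c j)%:C%C *: v j) ord0 l) = \sum_j c j * complex.Im (v j ord0 l).
  by rewrite summxE Im_sum; apply: eq_bigr => j _; rewrite mxE ImZ.
case: i => [[l sg]|] /=; last exact: reE.
rewrite /bary !reE imE -sumrB !mulr_suml mulr_sumr -big_split /=.
by apply: eq_bigr => j _; ring.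
Qed.

Lemma coords_vertex (R : realType) (k : nat) (i i' : option ('I_k * bool)) :
  coords (@vertex R k i) i' = if i' is Some _ then (i == i')%:R else 1.
Proof.
case: i' => [[l sg]|] /=; case: i => [[l' sg']|]; rewrite !mxE ?bary1//=.
rewrite (inj_eq lift_inj) [Some _ == _](inj_eq Some_inj) xpair_eqE [l == l']eq_sym.
by case: eqVneq => [_|_]; rewrite ?bary1// bary_omega eq_sym.
Qed.

(** The columns of a 0/1 matrix with more rows than columns satisfy a common
    linear relation; along the moment curve such a relation is a nonzero polynomial, and
    the finitely many polynomials obtained in this way have finitely many roots. *)
Lemma moment_point_outside_spans (R : realType) (N m : nat) (U : 'M[R]_N) :
  (m < N)%N -> (forall c : 'rV[R]_N, c *m U = 0 -> c = 0) ->
  exists2 t : R, 0 < t & forall (A : 'M[bool]_(N, m)) (s : 'cV[R]_m),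
    U *m (\col_i t ^+ i) <> map_mx (fun b : bool => b%:R) A *m s.
Proof.
move=> mN Uinj.
have /choice[c cP] : forall A : 'M[bool]_(N, m), exists c : 'rV[R]_N,
    c != 0 /\ c *m map_mx (fun b : bool => b%:R) A = 0.
  move=> A; set B := map_mx _ A.
  have : kermx B != 0.
    rewrite kermx_eq0 /row_free neq_ltn; apply/orP; left.
    by apply: leq_ltn_trans mN; exact: rank_leq_col.
  by move=> /rowV0Pn[c /sub_kermxP cB c0]; exists c.
pose q A : {poly R} := rVpoly (c A *m U).
have q0 A : q A != 0.
  apply/eqP => qA; have [/eqP cA _] := cP A; apply: cA; apply: Uinj.
  by apply: (can_inj rVpolyK); rewrite [LHS]qA linear0.
pose Q := \prod_(A : 'M[bool]_(N, m)) q A.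
have Q0 : Q != 0 by apply/prodf_neq0 => A _; exact: q0.
pose rs := [seq (i.+1%:R : R) | i <- iota 0 (size Q)].
have [t trs Qt] : exists2 t, t \in rs & ~~ root Q t.
  apply/allPn/negP => allr.
  have : uniq rs.
    rewrite map_inj_uniq ?iota_uniq// => i j /eqP.
    by rewrite eqr_nat => /eqP[].
  by move=> /(max_poly_roots Q0 allr); rewrite size_map size_iota ltnn.
exists t; first by case/mapP: trs => i _ ->; rewrite ltr0n.
move=> A s UA; move/negP: Qt; apply.
rewrite /Q (bigD1 A)//= rootM; apply/orP; left; apply/rootP.
rewrite /q /rVpoly horner_poly.
have : c A *m (U *m \col_i t ^+ i) = 0 by rewrite UA mulmxA (cP A).2 mul0mx.
rewrite mulmxA => /matrixP/(_ ord0 ord0); rewrite mxE [RHS]mxE => h; rewrite -[RHS]h.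
by apply: eq_bigr => i _; rewrite valK mxE.
Qed.

(** The vector [X] is a positive combination of the [2k + 1] vectors [vertex i], with
    weights on the moment curve, so its Kobayashi-Buseman metric is at most the sum [T] of
    the weights, which is also its first coordinate. A decomposition of total length [T]
    uses only multiples of extremal vectors, and [2k] of those do not span [X]. *)
Lemma order_neq_buseman (R : realType) (k : nat) : (0 < k)%N ->
  kobayashi_order (@cubic_domain R k) (2 * k) 0 <> kobayashi_buseman (@cubic_domain R k) 0.
Proof.
move=> k0 orderE.
pose I := option ('I_k * bool); pose N := #|{: I}|.
(* The k-fold product of triangles of the cube roots of unity has affine
   dimension 2k; together with the scaling this gives N coordinates. *)
have NE : N = (2 * k).+1 by rewrite /N card_option card_prod card_ord card_bool mulnC.
pose U : 'M[R]_N := \matrix_(i, j) coords (@vertex R k (enum_val j)) (enum_val i).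
have Uinj (c : 'rV[R]_N) : c *m U = 0 -> c = 0.
  move=> cU; pose i0 : 'I_N := enum_rank (None : I).
  have i0E (i : 'I_N) : (enum_val i == None) = (i == i0).
    by rewrite -(inj_eq enum_val_inj) enum_rankK.
  have Uij (i j : 'I_N) : U i j = if i == i0 then 1 else (i == j)%:R.
    rewrite mxE coords_vertex -i0E; case E : (enum_val i) => [p|] //=.
    by rewrite -E (inj_eq enum_val_inj) eq_sym.
  have cUj j : c ord0 i0 + (if j == i0 then 0 else c ord0 j) = 0.
    have := congr1 (fun M : 'rV_N => M ord0 j) cU; rewrite mxE [RHS]mxE => cUj.
    rewrite -[RHS]cUj (bigD1 i0)//= Uij eqxx mulr1; congr (_ + _).
    case: eqVneq => [->|ji0].
      by rewrite big1// => i ii0; rewrite Uij (negbTE ii0) mulr0.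
    rewrite (bigD1 j)//= Uij (negbTE ji0) eqxx mulr1 big1 ?addr0// => i /andP[ii0 ij].
    by rewrite Uij (negbTE ii0) (negbTE ij) mulr0.
  have c0 : c ord0 i0 = 0 by have := cUj i0; rewrite eqxx addr0.
  apply/rowP => j; rewrite [RHS]mxE; have := cUj j; rewrite c0 add0r.
  by case: eqVneq => [->|_].
have mN : (2 * k < N)%N by rewrite NE.
have [t t0 tP] := moment_point_outside_spans mN Uinj.
pose w (i : I) : R := t ^+ (enum_rank i : 'I_N).
have w0 i : 0 < w i by rewrite exprn_gt0.
pose X : 'rV[Cplx R]_k.+1 := \sum_i (w i)%:C%C *: vertex R i.
pose T := \sum_i w i.
have coordsX i : coords X i = (U *m (\col_j t ^+ j)) (enum_rank i) ord0.
  rewrite coords_sum mxE [RHS](reindex (@enum_rank I)) /=; last first.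
    exact: (onW_bij _ (@enum_rank_bij I)).
  by apply: eq_bigr => j _; rewrite !mxE !enum_rankK mulrC.
have X0 : complex.Re (X ord0 ord0) = T.
  rewrite -[LHS]/(coords X None) coords_sum; apply: eq_bigr => i _.
  by rewrite coords_vertex mulr1.
have [[B0 BD BZ] Bk _] := kobayashi_busemanP (@cubic_domain R k) 0.
have XT : kobayashi_order (@cubic_domain R k) (2 * k) 0 X <= T.
  rewrite orderE; apply: (big_ind2 (fun u (x : R) => kobayashi_buseman (@cubic_domain R k) 0 u <= x)).
  - by have := BZ 0 0; rewrite scale0r normc0 mul0r => ->.
  - by move=> u x v y ux vy; rewrite (le_trans (BD _ _))// lerD.
  - move=> i _; rewrite BZ normc_real gtr0_norm// ger_pMr//.
    by apply: le_trans (Bk _) _; apply: kobayashi_cubic_le1; rewrite ?cubic_gauge_vertex.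
have m0 : (0 < 2 * k)%N by rewrite muln_gt0.
have [b [y [Xby bT yk]]] := attained_decomposition k0 m0 XT.
(* The first coordinate of X is T, while that of b_i y_i has modulus at most |b_i|
   and the |b_i| sum to at most T: equality holds everywhere. *)
have Re_le i : complex.Re (b i * y i ord0 ord0) <= normc (b i).
  apply: le_trans (ler_norm _) _; apply: le_trans (Re_le_normc _) _; rewrite normcM.
  by rewrite ler_piMr ?normc_ge0// (cubic_gauge_coord0 k0).
have aligned i : complex.Re (b i * y i ord0 ord0) = normc (b i).
  have : \sum_i (normc (b i) - complex.Re (b i * y i ord0 ord0)) == 0.
    rewrite eq_le sumr_ge0 ?andbT; last by move=> j _; rewrite subr_ge0.
    rewrite sumrB subr_le0; apply: le_trans bT _; rewrite -X0 Xby summxE Re_sum.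
    by apply: ler_sum => j _; rewrite mxE.
  rewrite psumr_eq0 => [/allP/(_ i)|j _]; last by rewrite subr_ge0.
  by rewrite mem_index_enum subr_eq0 => /(_ isT)/eqP.
have by0 i : b i * y i ord0 ord0 = (normc (b i))%:C%C.
  have nle : normc (b i * y i ord0 ord0) <= normc (b i).
    by rewrite normcM ler_piMr ?normc_ge0// (cubic_gauge_coord0 k0).
  have : normc (b i * y i ord0 ord0) ^+ 2 <= normc (b i) ^+ 2.
    by rewrite ler_pXn2r ?nnegrE ?normc_ge0.
  rewrite sqr_normcE aligned gerDl => im0.
  have : complex.Im (b i * y i ord0 ord0) ^+ 2 == 0 by rewrite eq_le im0 sqr_ge0.
  rewrite sqrf_eq0 => /eqP im; apply/eqP; rewrite eq_complex /=.
  by rewrite aligned im !eqxx.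
have y1 i : b i != 0 -> normc (y i ord0 ord0) = 1.
  rewrite -normc_gt0 => bi0; apply: (mulfI (lt0r_neq0 bi0)).
  by rewrite mulr1 -normcM by0 normc_real ger0_norm ?normc_ge0.
(* Hence b_i y_i = |b_i| v_i, with v_i an extremal vector of first coordinate 1. *)
pose v i : 'rV[Cplx R]_k.+1 := (y i ord0 ord0)^-1 *: y i.
have vE i : b i *: y i = (normc (b i))%:C%C *: v i.
  have [->|bi0] := eqVneq (b i) 0; first by rewrite normc0 !scale0r.
  rewrite -by0 /v scalerA mulfK//.
  by rewrite -normc_eq0 y1// oner_eq0.
have v0 i : b i != 0 -> v i ord0 ord0 = 1.
  by move=> bi0; rewrite mxE mulVf// -normc_eq0 y1// oner_eq0.
have v3 i j : b i != 0 -> v i ord0 j ^+ 3 = 1.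
  move=> bi0; rewrite mxE exprMn exprVn (cubic_gauge_extremal j (yk i) (y1 i bi0)).
  by rewrite mulVf// expf_eq0 /= -normc_eq0 y1// oner_eq0.
(* X would be in the span of the coordinate vectors of the v_i, which are 0/1. *)
pose A : 'M[bool]_(N, 2 * k) := \matrix_(i, j)
  if enum_val i is Some (l, sg) then v j ord0 (lift ord0 l) == omega R sg else true.
apply: (tP A (\col_j normc (b j))).
apply/matrixP => i o; rewrite !ord1 {o}.
have := coordsX (enum_val i); rewrite enum_valK => <-.
rewrite Xby; under eq_bigr do rewrite vE.
rewrite coords_sum [RHS]mxE; apply: eq_bigr => j _; rewrite !mxE.
have [->|bj0] := eqVneq (b j) 0; first by rewrite normc0 mul0r mulr0.
rewrite mulrC; congr (_ * _).
case: (enum_val i) => [[l sg]|] /=; last by rewrite v0.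
rewrite v0//; have /eqP := v3 j (lift ord0 l) bj0; rewrite cube_root_unity.
move=> /or3P[] /eqP->; last 2 first.
- by rewrite bary_omega omega_eq eq_sym.
- by rewrite bary_omega omega_eq eq_sym.
by rewrite bary1 eq_sym (negbTE (omega_neq1 R sg)).
Qed.

Theorem theorem3p1 (R : realType) :
  (forall (n : nat) (D : set 'rV[Cplx R]_n), (1 <= n)%N -> domain D ->
     forall z : 'rV[Cplx R]_n, D z ->
       kobayashi_order D (2 * n - 1) z = kobayashi_buseman D z) /\
  (forall k : nat, let n := k.+1 in (2 <= n)%N ->
     kobayashi_order (@cubic_domain R k) (2 * n - 2) 0
       <> kobayashi_buseman (@cubic_domain R k) 0).
Proof.
split=> [n D n0 _ z Dz|k /= k0]; first exact: order_eq_buseman.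
by rewrite mulnS addKn; exact: order_neq_buseman.
Qed.
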